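(* Let $(u,p)$ be a smooth axially symmetric solution on $\mathbb{R}^3$ of the stationary Navier–Stokes equations, written in cylindrical coordinates as $$\begin{cases} b\cdot\nabla u_r-\Delta_0 u_r+\frac{u_r}{r^2}-\frac{u_\theta^2}{r}+\partial_r p=0,\\ b\cdot\nabla u_\theta-\Delta_0 u_\theta+\frac{u_\theta}{r^2}+\frac{u_ru_\theta}{r}=0,\\ b\cdot\nabla u_z-\Delta_0 u_z+\partial_z p=0,\\ \partial_r(ru_r)+\partial_z(ru_z)=0,\end{cases}$$ satisfying $$\lim_{|x|\to\infty}u(x)=0\qquad\text{and}\qquad \int_{\mathbb{R}^3}|\nabla u|^2\,dx<\infty .$$ Suppose moreover that for some $\beta>\frac53$ and some constant $C$ the vorticity components satisfy $$|(w_r,w_\theta,w_z)(r,z)|\le \frac{C}{r^{\beta}}\qquad\text{for all } r>0,\ z\in\mathbb{R}.$$ Then $u\equiv 0$.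
   Context: For $x=(x_1,x_2,x_3)\in\mathbb{R}^3$ put $r=\sqrt{x_1^2+x_2^2}$, $z=x_3$, and $e_r=(\frac{x_1}{r},\frac{x_2}{r},0)$, $e_\theta=(-\frac{x_2}{r},\frac{x_1}{r},0)$, $e_z=(0,0,1)$. A vector field $u$ on $\mathbb{R}^3$ is axially symmetric if $u=u_r(r,z)e_r+u_\theta(r,z)e_\theta+u_z(r,z)e_z$, with components depending only on $(r,z)$. Notation: $b=u_re_r+u_ze_z$, so that $b\cdot\nabla=u_r\partial_r+u_z\partial_z$ on functions of $(r,z)$, and $\Delta_0=\partial_{rr}+\frac1r\partial_r+\partial_{zz}$. The displayed system is the cylindrical-coordinate form, for axially symmetric $u$ and $p=p(r,z)$, of the stationary Navier–Stokes system $-\Delta u+u\cdot\nabla u=-\nabla p$, $\nabla\cdot u=0$ in $\mathbb{R}^3$; smooth means that $u$ and $p$ are smooth on $\mathbb{R}^3$. The vorticity is $w=\nabla\times u=w_re_r+w_\theta e_\theta+w_ze_z$ with $w_r=-\partial_z u_\theta$, $w_\theta=\partial_z u_r-\partial_r u_z$, $w_z=\frac{1}{r}\partial_r(ru_\theta)$. *)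

(* Defs.v *)
From HB Require Import structures.
From mathcomp Require Import all_boot all_order all_algebra.
From mathcomp Require Import all_classical all_reals all_analysis.
Set Implicit Arguments.
Unset Strict Implicit.
Unset Printing Implicit Defensive.
Import Order.TTheory GRing.Theory Num.Theory.
Import numFieldNormedType.Exports.
Local Open Scope classical_set_scope.
Local Open Scope ring_scope.

Section Space.
Context {R : realType}.

Definition vec3 (a b c : R) : 'rV[R]_3 := \row_(i < 3) [:: a; b; c]`_i.

Definition basis3 (i : 'I_3) : 'rV[R]_3 := delta_mx 0 i.

(* The library norm on ['rV_3] is the sup norm. *)
Definition enorm3 (x : 'rV[R]_3) : R := Num.sqrt (\sum_(i < 3) x 0 i ^+ 2).

Fixpoint Ck (W : normedModType R) (k : nat) (f : 'rV[R]_3 -> W) : Prop :=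
  match k with
  | 0%N => continuous f
  | k'.+1 => continuous f /\
      forall i : 'I_3, (forall x, derivable f x (basis3 i)) /\
                       Ck k' (fun x => 'D_(basis3 i) f x)
  end.

Definition smooth (W : normedModType R) (f : 'rV[R]_3 -> W) : Prop :=
  forall k, Ck k f.

Definition vanishes_at_infinity (u : 'rV[R]_3 -> 'rV[R]_3) : Prop :=
  forall e, 0 < e ->
    exists M : R, forall x, M < enorm3 x -> enorm3 (u x) < e.

Definition grad_sq (u : 'rV[R]_3 -> 'rV[R]_3) (x : 'rV[R]_3) : R :=
  \sum_(i < 3) \sum_(j < 3) ('D_(basis3 i) u x) 0 j ^+ 2.

(* Lebesgue measure on R^3 is the product measure on triples, and [vec3]
   carries triples to row vectors. *)
Definition dirichlet_integral (u : 'rV[R]_3 -> 'rV[R]_3) : \bar R :=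
  (\int[(lebesgue_measure \x lebesgue_measure) \x lebesgue_measure]_y
     (grad_sq u (vec3 y.1.1 y.1.2 y.2))%:E)%E.

End Space.

Section Cylindrical.
Context {R : realType}.

Definition rad (x : 'rV[R]_3) : R := Num.sqrt (x 0 0 ^+ 2 + x 0 1 ^+ 2).
Definition zcoord (x : 'rV[R]_3) : R := x 0 2.

Definition e_r (x : 'rV[R]_3) : 'rV[R]_3 :=
  vec3 (x 0 0 / rad x) (x 0 1 / rad x) 0.
Definition e_theta (x : 'rV[R]_3) : 'rV[R]_3 :=
  vec3 (- (x 0 1 / rad x)) (x 0 0 / rad x) 0.
Definition e_z : 'rV[R]_3 := vec3 0 0 1.

(* The frame is undefined on the axis, so the decomposition is required off
   the axis only; the values of the components at r <= 0 are irrelevant. *)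
Definition axially_symmetric (u : 'rV[R]_3 -> 'rV[R]_3)
    (ur uth uz : R -> R -> R) : Prop :=
  forall x, 0 < rad x ->
    u x = ur (rad x) (zcoord x) *: e_r x + uth (rad x) (zcoord x) *: e_theta x
          + uz (rad x) (zcoord x) *: e_z.

Definition axially_symmetric_scalar (p : 'rV[R]_3 -> R) (q : R -> R -> R) :
    Prop :=
  forall x, p x = q (rad x) (zcoord x).

Definition dr (f : R -> R -> R) (r z : R) : R := derive1 (fun s => f s z) r.
Definition dz (f : R -> R -> R) (r z : R) : R := derive1 (fun s => f r s) z.

Definition Delta0 (f : R -> R -> R) (r z : R) : R :=
  dr (dr f) r z + r^-1 * dr f r z + dz (dz f) r z.

Definition b_grad (ur uz f : R -> R -> R) (r z : R) : R :=
  ur r z * dr f r z + uz r z * dz f r z.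

Definition navier_stokes_cyl (ur uth uz p : R -> R -> R) : Prop :=
  forall r z, 0 < r ->
  [/\ b_grad ur uz ur r z - Delta0 ur r z + ur r z / r ^+ 2
        - uth r z ^+ 2 / r + dr p r z = 0,
      b_grad ur uz uth r z - Delta0 uth r z + uth r z / r ^+ 2
        + ur r z * uth r z / r = 0,
      b_grad ur uz uz r z - Delta0 uz r z + dz p r z = 0
    & dr (fun s t => s * ur s t) r z + dz (fun s t => s * uz s t) r z = 0].

Definition vort_r (uth : R -> R -> R) (r z : R) : R := - dz uth r z.
Definition vort_theta (ur uz : R -> R -> R) (r z : R) : R :=
  dz ur r z - dr uz r z.
Definition vort_z (uth : R -> R -> R) (r z : R) : R :=
  r^-1 * dr (fun s t => s * uth s t) r z.

End Cylindrical.

(* Main.v *)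
Require Import Defs.
From HB Require Import structures.
From mathcomp Require Import all_boot all_order all_algebra.
From mathcomp Require Import all_classical all_reals all_analysis.
From mathcomp Require Import ring lra.

(** Let S be the Stokes stream function of the meridional velocity:
    u_r = - S_z / r, u_z = S_r / r, so that
    S_rr - S_r / r + S_zz = - r w_theta. Lowering beta keeps the vorticity bound
    on r >= 1, so one may assume 5/3 < beta < 2.

    Decay. On r >= 1 a large multiple of r^(3 - beta) is a strict supersolution
    of the equation of S, while e r^2 solves the homogeneous equation and
    dominates S at infinity for every e > 0, because u vanishes there. The
    maximum principle ([stream_comparison]) gives |S| <= A r^(3 - beta)
    ([stream_decay]). The function S / sqrt r solves a Poisson equation in the
    flat half plane with a zero order term and no first order term, so the
    interior gradient estimate on squares of side comparable to r
    ([gradient_estimate]) bounds u_r and u_z by a multiple of r^(1 - beta)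
    ([poloidal_decay]). Integrating (r u_theta)_r = r w_z from r = 1 bounds
    u_theta in the same way ([swirl_decay]).

    Enstrophy. With Q = p + |u|^2 / 2 the system reads
    curl w + w x u + grad Q = 0. It is tested with the divergence free field
    curl (phi (S / r) e_theta) + phi u_theta e_theta, where phi is a cutoff on
    the cylinder r <= L, |z| <= L. The pressure only enters through a
    divergence, the part phi u of the test field is orthogonal to w x u, and
    what remains is
      r phi |w|^2 = div (flux) + T
    where every term of T contains a derivative of phi
    ([energy_identity_algebra], [enstrophy_balance]). For r >= M the decay
    bounds give T <= D r^(4 - 3 beta) / L. The exponent is below -1 exactly
    when beta > 5/3, so the integral of this bound over the cylinder, of length
    2 L in z, is small with 1 / M uniformly in L. For r <= M half of the left
    side absorbs T up to an error O(1 / L^2), whose integral tends to zero.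
    Integrating ([divergence_inequality]) and letting L, then M, tend to
    infinity gives w = 0 ([vorticity_vanishes]).

    Conclusion. When w = 0, the comparison of S with k r for every k > 0 gives
    S = 0, hence u_r = u_z = 0, and r u_theta is constant in r and zero on the
    axis ([flow_vanishes]). *)

Set Implicit Arguments.
Unset Strict Implicit.
Unset Printing Implicit Defensive.
Import Order.TTheory GRing.Theory Num.Theory.
Import numFieldNormedType.Exports.
Local Open Scope classical_set_scope.
Local Open Scope ring_scope.

(** * Calculus in one variable *)

Section OneVariable.
Context {R : realType}.
Implicit Types (f g : R -> R) (x df dg : R).

(** The differentiation rules below are stated for explicit lambda terms and
    for products in R, the form in which [derive_with] meets them. *)
Lemma derD f g x df dg : is_derive x 1 f df -> is_derive x 1 g dg ->
  is_derive x 1 (fun s => f s + g s) (df + dg).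
Proof. exact: is_deriveD. Qed.

Lemma derN f x df : is_derive x 1 f df -> is_derive x 1 (fun s => - f s) (- df).
Proof. exact: is_deriveN. Qed.

Lemma derM f g x df dg : is_derive x 1 f df -> is_derive x 1 g dg ->
  is_derive x 1 (fun s => f s * g s) (df * g x + f x * dg).
Proof.
move=> hf hg; have := is_deriveM hf hg; move/is_derive_eq; apply.
by rewrite addrC /GRing.scale /= mulrC.
Qed.

Lemma derX f x df n : is_derive x 1 f df ->
  is_derive x 1 (fun s => f s ^+ n) (n%:R * f x ^+ n.-1 * df).
Proof.
move=> hf; have -> : (fun s => f s ^+ n) = f ^+ n.
  by apply/funext => s; rewrite exprfctE.
exact: is_deriveX.
Qed.

Lemma der_cst (c x : R) : is_derive x (1 : R) (fun=> c) 0.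
Proof. exact: is_derive_cst. Qed.

Lemma der_id x : is_derive x (1 : R) (fun s => s) 1.
Proof. exact: is_derive_id. Qed.

Lemma der_eq f x df dg : is_derive x 1 f df -> df = dg -> is_derive x 1 f dg.
Proof. exact: is_derive_eq. Qed.

Lemma der_val f x df : is_derive x 1 f df -> derive1 f x = df.
Proof. by move=> h; rewrite derive1E derive_val. Qed.

Lemma der_unique f x df dg : is_derive x 1 f df -> is_derive x 1 f dg -> df = dg.
Proof. by move=> /der_val <- /der_val <-. Qed.

Lemma derV (f : R -> R) (x df : R) : is_derive x 1 f df -> f x != 0 ->
  is_derive x 1 (fun s => (f s)^-1) (- df / f x ^+ 2).
Proof.
move=> hf fx; apply: der_eq (is_deriveV fx hf) _.
by rewrite /GRing.scale /= mulNr mulrC mulNr.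
Qed.

Lemma le_of_eq (x y : R) : x = y -> x <= y.
Proof. by move=> ->. Qed.

Lemma der_near f g x df : is_derive x 1 f df -> (\near x, f x = g x) ->
  is_derive x 1 g df.
Proof.
by move=> h fg; apply: near_eq_is_derive h; apply: filterS fg => y ->.
Qed.

Lemma der_comp f g x df dg : is_derive x 1 g dg -> is_derive (g x) 1 f df ->
  is_derive x 1 (fun s => f (g s)) (df * dg).
Proof.
by move=> hg hf; apply: is_derive_eq (is_derive1_comp hf hg) _; rewrite /GRing.scale.
Qed.

Lemma der_cont f x df : is_derive x 1 f df -> {for x, continuous f}.
Proof.
case=> h _; apply: differentiable_continuous; exact/derivable1_diffP.
Qed.

Lemma mean_value_ge_within f (df : R -> R) (a b k : R) : a <= b ->
  {within `[a, b], continuous f} ->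
  (forall x, a < x -> x < b -> is_derive x 1 f (df x)) ->
  (forall x, a < x -> x < b -> k <= df x) -> k * (b - a) <= f b - f a.
Proof.
move=> ab cf df1 kdf; move: ab; rewrite le_eqVlt => /predU1P[<-|ab].
  by rewrite !subrr mulr0.
have [|c] := @MVT _ f df a b ab _ cf.
  by move=> x; rewrite in_itv /= => /andP[ax xb]; exact: df1.
rewrite in_itv /= => /andP[ac cb] ->.
by rewrite ler_wpM2r ?subr_ge0 ?(ltW ab)// kdf.
Qed.

Lemma mean_value_ge f (df : R -> R) (a b k : R) : a <= b ->
  (forall x, a <= x -> x <= b -> is_derive x 1 f (df x)) ->
  (forall x, a < x -> x < b -> k <= df x) -> k * (b - a) <= f b - f a.
Proof.
move=> ab hd; apply: mean_value_ge_within => //.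
  apply: derivable_within_continuous => x; rewrite in_itv /= => /andP[ax xb].
  by case: (hd x ax xb).
by move=> x ax xb; apply: hd; exact: ltW.
Qed.

(** Second derivative test: if f''(c) > 0 and f'(c) = 0 then f' > 0 just to the
    right of c, so f exceeds f(c) there. *)
Lemma max_second_derivative f f1 (c e d2 : R) : 0 < e ->
  (forall x, `|x - c| < e -> is_derive x 1 f (f1 x)) ->
  is_derive c 1 f1 d2 ->
  (forall x, `|x - c| < e -> f x <= f c) -> f1 c = 0 /\ d2 <= 0.
Proof.
move=> e0 hf hf1 hmax.
have inI t : (t \in `](c - e), (c + e)[%R) = (`|t - c| < e).
  by rewrite in_itv /= ltr_distl.
have f1c : f1 c = 0.
  have /(_ _ _ _ _)h := @derive1_at_max _ f (c - e) (c + e) c.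
  apply: (der_unique (hf c _) (h _ _ _ _)); rewrite ?subrr ?normr0 //.
  - lra.
  - by move=> t; rewrite inI => /hf [].
  - by rewrite inI subrr normr0.
  - by move=> t; rewrite inI => /hmax.
split=> //; rewrite leNgt; apply/negP => d20.
have hc : h^-1 *: (f1 (h + c) - f1 c) @[h --> (0:R)^'] --> d2.
  case: hf1 => hd <-; have := hd; rewrite /derivable /derive.
  move=> /cvgP; by under eq_fun do rewrite /= scaler1.
have : \forall h \near (0:R)^', 0 < h^-1 *: (f1 (h + c) - f1 c).
  by move/cvgrPdist_lt : hc => /(_ _ d20); apply: filterS => h; rewrite ltr_distlC subrr => /andP[].
case=> e1 /= e10 he1.
pose d := Num.min e e1 / 2.
have m0 : 0 < Num.min e e1 by rewrite lt_min e0.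
have d0 : 0 < d by rewrite divr_gt0.
have de : d < e by have := ge_min e e e1; rewrite lexx /= /d; lra.
have de1 : d < e1 by have := ge_min e1 e e1; rewrite lexx orbT /d; lra.
have hab : c < c + d by lra.
have [||y] := @MVT _ f f1 c (c + d) hab.
- move=> x; rewrite in_itv /= => /andP[cx xd]; apply: hf.
  by rewrite ltr_norml; apply/andP; split; lra.
- apply: derivable_within_continuous => x; rewrite in_itv /= => /andP[cx xd].
  have xe : `|x - c| < e by rewrite ltr_norml; apply/andP; split; lra.
  by case: (hf x xe).
rewrite in_itv /= => /andP[cy yd] E.
have f1y : 0 < f1 y.
  have /= := he1 (y - c); rewrite sub0r normrN.
  have yc : 0 < y - c by lra.
  rewrite gtr0_norm// subrK f1c subr0 => H.
  have {H}: 0 < (y - c)^-1 * f1 y by apply: H; [lra|rewrite gt_eqF].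
  by rewrite pmulr_rgt0 ?invr_gt0.
have := hmax (c + d); rewrite addrAC subrr add0r gtr0_norm// => /(_ de).
have : 0 < f (c + d) - f c by rewrite E addrAC subrr add0r mulr_gt0.
lra.
Qed.

End OneVariable.

(** [derive_with tac] differentiates sums, products and powers syntactically;
    [tac] supplies the derivatives of the atoms. Type class resolution is kept
    out, because it would choose its own form of the derivative. *)
Ltac derive_with tac :=
  lazymatch goal with
  | |- is_derive _ _ (fun s => s) _ => notypeclasses refine (der_id _)
  | |- is_derive _ _ (fun _ => ?c) _ => notypeclasses refine (der_cst c _)
  | |- is_derive _ _ (fun s => (@?f s + @?g s)%R) _ =>
      notypeclasses refine (@derD _ f g _ _ _ _ _); derive_with tac
  | |- is_derive _ _ (fun s => (- @?f s)%R) _ =>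
      notypeclasses refine (@derN _ f _ _ _); derive_with tac
  | |- is_derive _ _ (fun s => (@?f s * @?g s)%R) _ =>
      notypeclasses refine (@derM _ f g _ _ _ _ _); derive_with tac
  | |- is_derive _ _ (fun s => (@?f s ^+ ?n)%R) _ =>
      notypeclasses refine (@derX _ f _ _ n _); derive_with tac
  | |- _ => tac
  end.

Ltac derive_eq tac := notypeclasses refine (der_eq _ _); [derive_with tac|cbv beta].

(** * Functions on the plane and integrals over segments *)

Section TwoVariables.
Context {R : realType}.
Implicit Types (f g v : R -> R -> R).

Definition cont2 f := continuous (fun y : R * R => f y.1 y.2).

(** [isdr f g] and [isdz f g] say that g is the partial derivative of f in the
    first, respectively second, variable. *)
Definition isdr f g := forall r z, is_derive r (1 : R) (fun s => f s z) (g r z).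
Definition isdz f g := forall r z, is_derive z (1 : R) (fun s => f r s) (g r z).

Lemma cont2_cst (k : R) : cont2 (fun _ _ => k).
Proof. by move=> y; exact: cvg_cst. Qed.

Lemma cont2_fst (h : R -> R) : continuous h -> cont2 (fun r _ => h r).
Proof.
move=> ch [r z]; apply: (@continuous_comp _ _ _ fst h (r, z)); first exact: cvg_fst.
exact: ch.
Qed.

Lemma cont2_snd (h : R -> R) : continuous h -> cont2 (fun _ z => h z).
Proof.
move=> ch [r z]; apply: (@continuous_comp _ _ _ snd h (r, z)); first exact: cvg_snd.
exact: ch.
Qed.

Lemma cont2D f g : cont2 f -> cont2 g -> cont2 (fun r z => f r z + g r z).
Proof. by move=> cf cg y; exact: continuousD (cf y) (cg y). Qed.

Lemma cont2N f : cont2 f -> cont2 (fun r z => - f r z).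
Proof. by move=> cf y; exact: continuousN (cf y). Qed.

Lemma cont2M f g : cont2 f -> cont2 g -> cont2 (fun r z => f r z * g r z).
Proof. by move=> cf cg y; exact: continuousM (cf y) (cg y). Qed.

Lemma cont2X f n : cont2 f -> cont2 (fun r z => f r z ^+ n).
Proof.
move=> cf; elim: n => [|n ih]; first exact: cont2_cst.
have -> : (fun r z => f r z ^+ n.+1) = (fun r z => f r z * f r z ^+ n).
  by apply/funext => r; apply/funext => z; rewrite exprS.
exact: cont2M.
Qed.

Lemma cont2_section_r f z : cont2 f -> continuous (fun s => f s z).
Proof.
move=> cf r; apply: (@continuous_comp _ _ _ (fun s => (s, z)) (fun y => f y.1 y.2)).
  exact: (cvg_pair (@cvg_id _ _) (cvg_cst _)).
exact: cf.
Qed.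

Lemma cont2_section_z f r : cont2 f -> continuous (fun s => f r s).
Proof.
move=> cf z; apply: (@continuous_comp _ _ _ (fun s => (r, s)) (fun y => f y.1 y.2)).
  exact: (cvg_pair (cvg_cst _) (@cvg_id _ _)).
exact: cf.
Qed.

Lemma cont2P f : cont2 f <-> forall r z e, 0 < e -> exists2 d : R, 0 < d &
  forall r' z', `|r' - r| < d -> `|z' - z| < d -> `|f r' z' - f r z| < e.
Proof.
split=> [cf r z e e0|h [r z]].
  have /cvgrPdist_lt/(_ e e0) := cf (r, z).
  move=> /= /nbhs_ballP[d /= d0 hd]; exists d => // r' z' hr hz.
  rewrite distrC; apply: (hd (r', z')); split; rewrite /ball /= distrC //.
apply/cvgrPdist_lt => e e0; have [d d0 hd] := h r z e e0.
apply: (nbhs_ballP (r, z) _).2; exists d => //= -[r' z'] [/= hr hz].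
by rewrite distrC; apply: hd; rewrite distrC.
Qed.

Lemma rectangle_compact (a b c d : R) :
  compact ([set` `[a, b]] `*` [set` `[c, d]] : set (R * R)).
Proof. by apply: compact_setX; exact: segment_compact. Qed.

Lemma rectangle_max f (a b c d : R) : a <= b -> c <= d ->
  (forall r z, a <= r <= b -> c <= z <= d ->
     {for (r, z), continuous (fun y : R * R => f y.1 y.2)}) ->
  exists r0 z0, [/\ a <= r0 <= b, c <= z0 <= d &
    forall r z, a <= r <= b -> c <= z <= d -> f r z <= f r0 z0].
Proof.
move=> ab cd cf.
have [||[r0 z0]] := @compact_EVT_max _ R (fun y : R * R => f y.1 y.2) _ _
  (@rectangle_compact a b c d).
- by exists (a, c); split => /=; rewrite in_itv /= lexx.
- apply: continuous_in_subspaceT => -[r z]; rewrite inE => -[/=].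
  by rewrite !in_itv /= => hr hz; exact: cf.
rewrite inE => -[/=]; rewrite !in_itv /= => hr hz hm.
exists r0, z0; split=> // r z ar cz; apply: (hm (r, z)).
by rewrite inE; split; rewrite /= in_itv.
Qed.

Lemma cont2_norm f : cont2 f -> cont2 (fun r z => `|f r z|).
Proof.
by move=> cf y; apply: cvg_norm; exact: cf.
Qed.

Lemma cont2_bounded f (a b c d : R) : cont2 f ->
  exists2 k : R, 0 <= k & forall r z, a <= r <= b -> c <= z <= d -> `|f r z| <= k.
Proof.
move=> cf; have [ab|ba] := leP a b; last first.
  by exists 0 => // r z /andP[ar rb]; lra.
have [cd|dc] := leP c d; last first.
  by exists 0 => // r z _ /andP[ar rb]; lra.
have [|r0 [z0 [_ _ hm]]] := @rectangle_max (fun r z => `|f r z|) a b c d ab cd.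
  by move=> r z _ _; exact: cont2_norm.
by exists `|f r0 z0|.
Qed.

Lemma increment_le (h dh : R -> R) (a b k : R) :
  (forall x, Num.min a b <= x -> x <= Num.max a b -> is_derive x 1 h (dh x)) ->
  (forall x, Num.min a b <= x -> x <= Num.max a b -> `|dh x| <= k) ->
  `|h b - h a| <= k * `|b - a|.
Proof.
wlog ab : a b / a <= b.
  move=> H hd hk; have [ab|ba] := leP a b; first exact: H.
  by rewrite distrC [`|b - a|]distrC; apply: H; rewrite ?(ltW ba)// minC maxC.
rewrite min_l // max_r // => hd hk.
rewrite [`|b - a|]ger0_norm ?subr_ge0//.
rewrite ler_norml; apply/andP; split.
  rewrite -mulNr; apply: (mean_value_ge ab hd) => x ax xb.
  by have := hk x (ltW ax) (ltW xb); rewrite ler_norml => /andP[].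
have : - k * (b - a) <= (- h b) - (- h a).
  apply: (@mean_value_ge _ (fun x => - h x) (fun x => - dh x) a b (- k) ab) => x ax xb.
    by apply: derN; exact: hd.
  by have := hk x (ltW ax) (ltW xb); rewrite ler_norml lerN2 => /andP[].
lra.
Qed.

Lemma cont2_comp v f g : cont2 v -> cont2 f -> cont2 g ->
  cont2 (fun r z => v (f r z) (g r z)).
Proof.
move=> cv cf cg y; pose h (y : R * R) := (f y.1 y.2, g y.1 y.2).
have ch : {for y, continuous h}.
  exact: (@cvg_pair _ _ _ (nbhs y) (nbhs (h y).1) (nbhs (h y).2) _ _ _ _ _ (cf y) (cg y)).
exact: (@continuous_comp _ _ _ h (fun y => v y.1 y.2) y ch (cv (h y))).
Qed.

(** Local boundedness of one partial derivative makes f Lipschitz in that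
    variable, which upgrades the separate continuity of f to joint continuity. *)
Lemma partials_cont2 f fr fz : isdr f fr -> isdz f fz -> cont2 fr -> cont2 f.
Proof.
move=> hr hz cfr; apply/cont2P => r z e e0.
have [k k0 hk] := cont2_bounded (r - 1) (r + 1) (z - 1) (z + 1) cfr.
have cz : {for z, continuous (fun s => f r s)} := der_cont (hz r z).
have /cvgrPdist_lt/(_ (e / 2)) := cz.
rewrite divr_gt0 // => /(_ isT) /nbhs_ballP[d /= d0 hd].
pose d' := Num.min (Num.min d 1) (e / 2 / (k + 1)).
have k1 : 0 < k + 1 by lra.
exists d'; first by rewrite !lt_min d0 ltr01 !divr_gt0.
move=> r' z'; rewrite !lt_min -!andbA => /and3P[_ r1 re] /and3P[zd z1 _].
have E1 : `|f r z' - f r z| < e / 2.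
  by rewrite distrC; apply: hd; rewrite /ball /= distrC.
have E2 : `|f r' z' - f r z'| <= k * `|r' - r|.
  apply: (@increment_le (fun s => f s z') (fun s => fr s z')) => x hx1 hx2; first exact: hr.
  apply: hk.
    move: r1 hx1 hx2; rewrite ltr_norml => /andP[? ?].
    by rewrite ge_min le_max => /orP[] ? /orP[] ?; apply/andP; split; lra.
  by move: z1; rewrite ltr_norml => /andP[? ?]; apply/andP; split; lra.
have E3 : k * `|r' - r| <= e / 2.
  apply: (@le_trans _ _ ((k + 1) * `|r' - r|)).
    by rewrite ler_wpM2r //; lra.
  by rewrite mulrC -ler_pdivlMr // ltW.
have -> : f r' z' - f r z = (f r' z' - f r z') + (f r z' - f r z) by ring.
by apply: le_lt_trans (ler_normD _ _) _; lra.
Qed.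

(** Two applications of the mean value theorem write the second difference of f
    over a small square once as frz times the area and once as fzr times the
    area. *)
Lemma mixed_partials f fr fz frz fzr :
  isdr f fr -> isdz f fz -> isdz fr frz -> isdr fz fzr ->
  cont2 frz -> cont2 fzr -> forall r z, frz r z = fzr r z.
Proof.
move=> hr hz hrz hzr c1 c2 r z; apply/eqP; rewrite -subr_eq0 -normr_le0.
apply/ler_addgt0Pl => e e0; rewrite addr0.
have e2 : 0 < e / 2 by rewrite divr_gt0.
have [d1 d10 h1] := (cont2P frz).1 c1 r z _ e2.
have [d2 d20 h2] := (cont2P fzr).1 c2 r z _ e2.
pose h := Num.min d1 d2 / 2.
have m0 : 0 < Num.min d1 d2 by rewrite lt_min d10.
have h0 : 0 < h by rewrite divr_gt0.
have hd1 : h < d1 by have := ge_min d1 d1 d2; rewrite lexx /= /h; lra.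
have hd2 : h < d2 by have := ge_min d2 d1 d2; rewrite lexx orbT /h; lra.
pose Dl := f (r + h) (z + h) - f (r + h) z - (f r (z + h) - f r z).
have segr (F dF : R -> R) a : (forall x, is_derive x (1:R) F (dF x)) ->
    exists2 x, a < x < a + h & F (a + h) - F a = dF x * h.
  move=> hF; have ah : a < a + h by lra.
  have [|x] := @MVT _ F dF a (a + h) ah (fun x _ => hF x).
    by apply: derivable_within_continuous => x _; case: (hF x).
  by rewrite in_itv /= => ax ->; exists x => //; congr (_ * _); ring.
have [x1 x1r E1] : exists2 x, r < x < r + h &
    (f (r + h) (z + h) - f (r + h) z) - (f r (z + h) - f r z) =
    (fr x (z + h) - fr x z) * h.
  apply: (segr (fun s => f s (z + h) - f s z) (fun s => fr s (z + h) - fr s z)).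
  by move=> x; apply: derD; [exact: hr|exact/derN/hr].
have [y1 y1z E2] := segr _ (frz x1) z (hrz x1).
have [y2 y2z E3] : exists2 x, z < x < z + h &
    (f (r + h) (z + h) - f r (z + h)) - (f (r + h) z - f r z) =
    (fz (r + h) x - fz r x) * h.
  apply: (segr (fun s => f (r + h) s - f r s) (fun s => fz (r + h) s - fz r s)).
  by move=> x; apply: derD; [exact: hz|exact/derN/hz].
have [x2 x2r E4] := segr (fun s => fz s y2) (fun s => fzr s y2) r (fun s => hzr s y2).
have E : frz x1 y1 = fzr x2 y2.
  have hh : h * h != 0 by rewrite mulf_neq0 ?gt_eqF.
  apply: (mulIf hh).
  have -> : frz x1 y1 * (h * h) = frz x1 y1 * h * h by ring.
  have -> : fzr x2 y2 * (h * h) = fzr x2 y2 * h * h by ring.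
  by rewrite -[frz x1 y1 * h]E2 -[fzr x2 y2 * h]E4 -E1 -E3; ring.
have near_h x a : a < x < a + h -> `|x - a| < h.
  by case/andP=> ? ?; rewrite ltr_norml; apply/andP; split; lra.
have A1 : `|frz x1 y1 - frz r z| < e / 2.
  by apply: h1; apply: lt_trans hd1; exact: near_h.
have A2 : `|fzr x2 y2 - fzr r z| < e / 2.
  by apply: h2; apply: lt_trans hd2; exact: near_h.
have -> : frz r z - fzr r z = (fzr x2 y2 - fzr r z) - (frz x1 y1 - frz r z).
  by rewrite E; ring.
by apply: le_trans (ler_normB _ _) _; lra.
Qed.

End TwoVariables.

Section SegmentIntegral.
Context {R : realType}.
Implicit Types (f g : R -> R -> R).

Definition segint (a b : R) (h : R -> R) : R :=
  \int[@lebesgue_measure R]_(x in `[a, b]) h x.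

Lemma continuous_integrable_segment (a b : R) (h : R -> R) : continuous h ->
  (@lebesgue_measure R).-integrable `[a, b] (EFin \o h).
Proof.
move=> ch; apply: continuous_compact_integrable; first exact: segment_compact.
exact: continuous_subspaceT.
Qed.

Lemma segintD (a b : R) (h k : R -> R) : continuous h -> continuous k ->
  segint a b (fun x => h x + k x) = segint a b h + segint a b k.
Proof.
by move=> ch ck; apply: RintegralD => //; exact: continuous_integrable_segment.
Qed.

Lemma segint_derive (a b : R) (F h : R -> R) : a < b -> continuous h ->
  (forall x, is_derive x (1:R) F (h x)) -> segint a b h = F b - F a.
Proof.
move=> ab ch hF; rewrite /segint /Rintegral (@continuous_FTC2 _ h F a b) //.
- exact: continuous_subspaceT.
- split.
  + by move=> x _; case: (hF x).
  + by apply: cvg_at_right_filter; exact: der_cont (hF a).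
  + by apply: cvg_at_left_filter; exact: der_cont (hF b).
- by move=> x _; exact: der_val.
Qed.

(** A lower bound of a nonnegative integrand on a subinterval bounds the
    integral. *)
Lemma segint_step (a b c d k : R) (h : R -> R) : continuous h ->
  a <= c -> c <= d -> d <= b -> 0 <= k ->
  (forall x, a <= x <= b -> 0 <= h x) -> (forall x, c <= x <= d -> k <= h x) ->
  k * (d - c) <= segint a b h.
Proof.
move=> ch ac cd db k0 h0 hk.
apply: (@le_trans _ _ (\int[@lebesgue_measure R]_(x in `[c, d]) k)).
  move: cd; rewrite le_eqVlt => /predU1P[<-|cd].
    by rewrite subrr mulr0; apply: Rintegral_ge0 => x _.
  have ck : continuous (fun _ : R => k) by move=> x; exact: cvg_cst.
  have dk x : is_derive x (1:R) (fun s => k * s) k.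
    by apply: der_eq (derM (der_cst k x) (der_id x)) _; ring.
  have := segint_derive cd ck dk; rewrite /segint -mulrBr => E.
  by rewrite -E lexx.
apply: (@le_trans _ _ (segint c d h)).
  apply: le_Rintegral => //; try exact: continuous_integrable_segment.
    by apply: continuous_integrable_segment => x; exact: cvg_cst.
rewrite /segint /Rintegral fine_le //.
- by apply: integrable_fin_num => //; exact: continuous_integrable_segment.
- by apply: integrable_fin_num => //; exact: continuous_integrable_segment.
apply: ge0_subset_integral => //.
- by have /integrableP[] := @continuous_integrable_segment a b h ch.
- by move=> x /=; rewrite !in_itv /= => /andP[? ?]; apply/andP; split; lra.
Qed.

Lemma segint_param (a b : R) f fr : cont2 f -> isdr f fr -> cont2 fr ->
  forall r, is_derive r (1:R) (fun s => segint a b (f s)) (segint a b (fr r)).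
Proof.
move=> cf hfr cfr r.
have [k k0 hk] := cont2_bounded (r - 1) (r + 1) a b cfr.
have rI : `](r - 1), (r + 1)[%classic r by rewrite /= in_itv /=; apply/andP; split; lra.
have i1 x : `](r - 1), (r + 1)[%classic x ->
    (@lebesgue_measure R).-integrable `[a, b] (EFin \o f x).
  by move=> _; apply: continuous_integrable_segment; exact: cont2_section_z.
have i2 x y : `](r - 1), (r + 1)[%classic x -> `[a, b]%classic y -> derivable (f ^~ y) x 1.
  by move=> _ _; case: (hfr x y).
have i3 : (@lebesgue_measure R).-integrable `[a, b] (EFin \o (fun=> k)).
  by apply: continuous_integrable_segment => x; exact: cvg_cst.
have i4 x y : `](r - 1), (r + 1)[%classic x -> `[a, b]%classic y ->
    `|partial1of2 f x y| <= (fun=> k) y.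
  rewrite /= !in_itv /= => /andP[? ?] hy.
  have -> : partial1of2 f x y = fr x y by exact: der_val (hfr x y).
  by apply: hk => //; apply/andP; split; lra.
have D1 := @derivable_under_integral R _ _ (@lebesgue_measure R) f `[a, b]
  (measurable_itv _) r _ _ rI i1 i2 (fun=> k) (fun _ => k0) i3 i4.
have D2 := @differentiation_under_integral R _ _ (@lebesgue_measure R) f `[a, b]
  (measurable_itv _) r _ _ rI i1 i2 (fun=> k) (fun _ => k0) i3 i4.
split; first exact: D1.
rewrite -derive1E [LHS]D2.
apply: eq_Rintegral => y _; exact: der_val (hfr r y).
Qed.

End SegmentIntegral.

(** * Maximum principle and interior gradient estimate *)

Section MaximumPrinciple.
Context {R : realType}.
Implicit Types (D v S : R -> R -> R).

Lemma continuous_pair_comp v (f g : R * R -> R) y :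
  {for y, continuous f} -> {for y, continuous g} ->
  {for (f y, g y), continuous (fun y : R * R => v y.1 y.2)} ->
  {for y, continuous (fun y => v (f y) (g y))}.
Proof.
move=> cf cg cv; have cfg : {for y, continuous (fun y => (f y, g y))}.
  exact: (@cvg_pair _ _ _ (nbhs y) (nbhs (f y)) (nbhs (g y)) _ _ _ f g cf cg).
exact: (@continuous_comp _ _ _ (fun y => (f y, g y)) (fun y => v y.1 y.2) y cfg cv).
Qed.

(** At an interior maximum D_r = 0, D_rr <= 0 and D_zz <= 0, which contradicts
    the strict inequality; so the maximum sits on the boundary. *)
Lemma weak_maximum_principle D Dr Drr Dz Dzz (k : R -> R -> R) (a b c d : R) :
  (forall r z, a <= r <= b -> c <= z <= d ->
     {for (r, z), continuous (fun y : R * R => D y.1 y.2)}) ->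
  (forall r z, a < r < b -> c < z < d ->
     [/\ is_derive r (1 : R) (fun s => D s z) (Dr r z),
         is_derive r (1 : R) (fun s => Dr s z) (Drr r z),
         is_derive z (1 : R) (fun s => D r s) (Dz r z),
         is_derive z (1 : R) (fun s => Dz r s) (Dzz r z) &
         0 < Drr r z + k r z * Dr r z + Dzz r z]) ->
  (forall z, c <= z <= d -> D a z <= 0 /\ D b z <= 0) ->
  (forall r, a <= r <= b -> D r c <= 0 /\ D r d <= 0) ->
  forall r z, a <= r <= b -> c <= z <= d -> D r z <= 0.
Proof.
move=> cD hD bd1 bd2 r z hr hz.
have ab : a <= b by case/andP: hr => ? ?; lra.
have cd : c <= d by case/andP: hz => ? ?; lra.
have [r0 [z0 [hr0 hz0 hm]]] := rectangle_max ab cd cD.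
apply: le_trans (hm r z hr hz) _.
have [ar|ar] := eqVneq r0 a; first by rewrite ar; case: (bd1 z0 hz0).
have [br|br] := eqVneq r0 b; first by rewrite br; case: (bd1 z0 hz0).
have [cz|cz] := eqVneq z0 c; first by rewrite cz; case: (bd2 r0 hr0).
have [dz|dz] := eqVneq z0 d; first by rewrite dz; case: (bd2 r0 hr0).
have hr0' : a < r0 < b.
  by case/andP: hr0 => ? ?; rewrite !lt_def ar eq_sym br; apply/andP; split.
have hz0' : c < z0 < d.
  by case/andP: hz0 => ? ?; rewrite !lt_def cz eq_sym dz; apply/andP; split.
have [_ h2 _ h4 hpos] := hD r0 z0 hr0' hz0'.
move: (hr0') (hz0') => /andP[lr1 lr2] /andP[lz1 lz2].
have [Dr0 Drr0] : Dr r0 z0 = 0 /\ Drr r0 z0 <= 0.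
  apply: (@max_second_derivative R (fun s => D s z0) (fun s => Dr s z0) r0
    (Num.min (r0 - a) (b - r0))) => //.
  - by rewrite lt_min; apply/andP; split; lra.
  - move=> x; rewrite lt_min => /andP[]; rewrite !ltr_norml => /andP[? ?] /andP[? ?].
    have hx : a < x < b by apply/andP; split; lra.
    by case: (hD x z0 hx hz0').
  - move=> x; rewrite lt_min => /andP[]; rewrite !ltr_norml => /andP[? ?] /andP[? ?].
    by apply: hm => //; apply/andP; split; lra.
have [_ Dzz0] : Dz r0 z0 = 0 /\ Dzz r0 z0 <= 0.
  apply: (@max_second_derivative R (fun s => D r0 s) (fun s => Dz r0 s) z0
    (Num.min (z0 - c) (d - z0))) => //.
  - by rewrite lt_min; apply/andP; split; lra.
  - move=> x; rewrite lt_min => /andP[]; rewrite !ltr_norml => /andP[? ?] /andP[? ?].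
    have hx : c < x < d by apply/andP; split; lra.
    by case: (hD r0 x hr0' hx).
  - move=> x; rewrite lt_min => /andP[]; rewrite !ltr_norml => /andP[? ?] /andP[? ?].
    by apply: hm => //; apply/andP; split; lra.
by move: hpos; rewrite Dr0 mulr0 addr0; lra.
Qed.

Lemma der_right_ge0 (h : R -> R) (h' e : R) : 0 < e -> is_derive 0 (1 : R) h h' ->
  h 0 = 0 -> (forall x, 0 < x < e -> 0 <= h x) -> 0 <= h'.
Proof.
move=> e0 hd h0 hpos; rewrite leNgt; apply/negP => hneg.
have hc : x^-1 *: (h (x + 0) - h 0) @[x --> (0:R)^'] --> h'.
  case: hd => hd <-; have := hd; rewrite /derivable /derive.
  by move=> /cvgP; under eq_fun do rewrite /= scaler1.
have : \forall x \near (0:R)^', x^-1 *: (h (x + 0) - h 0) < 0.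
  have n0 : 0 < - h' by lra.
  move/cvgrPdist_lt : hc => /(_ _ n0); apply: filterS => x.
  by rewrite ltr_distlC => /andP[_]; rewrite subrr.
case=> e1 /= e10 he1.
pose x := Num.min e e1 / 2.
have m0 : 0 < Num.min e e1 by rewrite lt_min e0.
have x0 : 0 < x by rewrite divr_gt0.
have xe : x < e by have := ge_min e e e1; rewrite lexx /= /x; lra.
have xe1 : x < e1 by have := ge_min e1 e e1; rewrite lexx orbT /x; lra.
have := he1 x; rewrite /= sub0r normrN gtr0_norm // => /(_ xe1).
rewrite gt_eqF // h0 subr0 addr0 => /(_ isT).
have : 0 <= h x by apply: hpos; rewrite x0.
by move=> hx0; rewrite ltNge; rewrite mulr_ge0 // invr_ge0 ltW.
Qed.

(** Reflection in the line r = r0: half the difference of v at r0 + x and at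
    r0 - x vanishes on the line x = 0, is at most M on the rest of the boundary
    of the half square, and has Laplacian of modulus at most N. The barrier B
    dominates it on the boundary, has Laplacian - N and vanishes at the origin;
    comparing the derivatives in x at the origin gives the bound. *)
Lemma gradient_upper v vr vrr vz vzz (r0 z0 d M N : R) :
  0 < d ->
  (forall r z, `|r - r0| <= d -> `|z - z0| <= d ->
     [/\ is_derive r (1 : R) (fun s => v s z) (vr r z),
         is_derive r (1 : R) (fun s => vr s z) (vrr r z),
         is_derive z (1 : R) (fun s => v r s) (vz r z),
         is_derive z (1 : R) (fun s => vz r s) (vzz r z) &
         {for (r, z), continuous (fun y : R * R => v y.1 y.2)}]) ->
  (forall r z, `|r - r0| <= d -> `|z - z0| <= d -> `|v r z| <= M) ->
  (forall r z, `|r - r0| <= d -> `|z - z0| <= d -> `|vrr r z + vzz r z| < N) ->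
  vr r0 z0 <= 2 * M / d + N * d / 2.
Proof.
move=> d0 hv hM hN.
have z00 : `|z0 - z0| <= d by rewrite subrr normr0 ltW.
have r00 : `|r0 - r0| <= d by rewrite subrr normr0 ltW.
have M0 : 0 <= M by apply: le_trans (hM _ _ r00 z00).
have N0 : 0 < N by apply: le_lt_trans (hN _ _ r00 z00).
pose m := M / d ^+ 2.
have m0 : 0 <= m by rewrite divr_ge0 // exprn_ge0 // ltW.
have mE : m * d ^+ 2 = M by rewrite divfK // expf_neq0 // gt_eqF.
pose B x y : R := m * (y ^+ 2 + x * (2 * d - x)) + N / 2 * (x * (d - x)).
pose D x y : R := 2^-1 * (v (r0 + x) (z0 + y) - v (r0 - x) (z0 + y)) - B x y.
have sq x y : 0 <= x <= d -> - d <= y <= d -> [/\ `|r0 + x - r0| <= d,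
    `|r0 - x - r0| <= d & `|z0 + y - z0| <= d].
  by move=> /andP[? ?] /andP[? ?]; split; rewrite ler_norml; apply/andP; split; lra.
have key x : 0 <= x <= d -> D x 0 <= 0.
  have z0d : - d <= 0 <= d by apply/andP; split; lra.
  move=> hx; have wmp := @weak_maximum_principle D
    (fun x y => 2^-1 * (vr (r0 + x) (z0 + y) + vr (r0 - x) (z0 + y)) -
       (m * (2 * d - 2 * x) + N / 2 * (d - 2 * x)))
    (fun x y => 2^-1 * (vrr (r0 + x) (z0 + y) - vrr (r0 - x) (z0 + y)) -
       (m * (- 2) + N / 2 * (- 2)))
    (fun x y => 2^-1 * (vz (r0 + x) (z0 + y) - vz (r0 - x) (z0 + y)) - m * (2 * y))
    (fun x y => 2^-1 * (vzz (r0 + x) (z0 + y) - vzz (r0 - x) (z0 + y)) - m * 2)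
    (fun _ _ => 0) 0 d (- d) d.
  apply: (wmp _ _ _ _ x 0 hx z0d) => {wmp}.
  - move=> r z hr hz; have [s1 s2 s3] := sq r z hr hz.
    have [_ _ _ _ c1] := hv _ _ s1 s3; have [_ _ _ _ c2] := hv _ _ s2 s3.
    have cB : cont2 B.
      apply: cont2D; apply: cont2M; try exact: cont2_cst.
        apply: cont2D; first by apply: cont2X; apply: cont2_snd => ?; exact: cvg_id.
        apply: cont2M; first by apply: cont2_fst => ?; exact: cvg_id.
        apply: cont2D; first exact: cont2_cst.
        by apply: cont2N; apply: cont2_fst => ?; exact: cvg_id.
      apply: cont2M; first by apply: cont2_fst => ?; exact: cvg_id.
      apply: cont2D; first exact: cont2_cst.
      by apply: cont2N; apply: cont2_fst => ?; exact: cvg_id.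
    apply: cvgB; last exact: cB.
    apply: cvgM; first exact: cvg_cst.
    have cz : {for (r, z), continuous (fun y : R * R => z0 + y.2)}.
      by apply: cvgD; [exact: cvg_cst|exact: cvg_snd].
    apply: cvgB.
      apply: (@continuous_pair_comp v (fun y : R * R => r0 + y.1)) => //.
      by apply: cvgD; [exact: cvg_cst|exact: cvg_fst].
    apply: (@continuous_pair_comp v (fun y : R * R => r0 - y.1)) => //.
    by apply: cvgB; [exact: cvg_cst|exact: cvg_fst].
  - move=> r z /andP[r1 r2] /andP[z1 z2].
    have hr : 0 <= r <= d by rewrite !ltW.
    have hz : - d <= z <= d by rewrite !ltW.
    have [s1 s2 s3] := sq r z hr hz.
    have [a1 a2 a3 a4 _] := hv _ _ s1 s3; have [b1 b2 b3 b4 _] := hv _ _ s2 s3.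
    have shp (u w : R) : is_derive w (1 : R) (fun s => u + s) 1.
      by apply: der_eq (derD (der_cst u w) (der_id w)) _; ring.
    have shm (u w : R) : is_derive w (1 : R) (fun s => u - s) (- 1).
      by apply: der_eq (derD (der_cst u w) (derN (der_id w))) _; ring.
    have p1 := der_comp (f := fun s => v s (z0 + z)) (shp r0 r) a1.
    have p2 := der_comp (f := fun s => v s (z0 + z)) (shm r0 r) b1.
    have p3 := der_comp (f := fun s => vr s (z0 + z)) (shp r0 r) a2.
    have p4 := der_comp (f := fun s => vr s (z0 + z)) (shm r0 r) b2.
    have p5 := der_comp (f := fun s => v (r0 + r) s) (shp z0 z) a3.
    have p6 := der_comp (f := fun s => v (r0 - r) s) (shp z0 z) b3.
    have p7 := der_comp (f := fun s => vz (r0 + r) s) (shp z0 z) a4.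
    have p8 := der_comp (f := fun s => vz (r0 - r) s) (shp z0 z) b4.
    split.
    + rewrite /D /B; derive_eq ltac:(eassumption).
      by rewrite /=; field.
    + derive_eq ltac:(eassumption).
      by rewrite /=; field.
    + rewrite /D /B; derive_eq ltac:(eassumption).
      by rewrite /=; field.
    + derive_eq ltac:(eassumption).
      by rewrite /=; field.
    + have := hN _ _ s1 s3; have := hN _ _ s2 s3.
      rewrite !ltr_norml => /andP[? ?] /andP[? ?]; lra.
  - move=> z hz; split.
      rewrite /D /B addr0 subr0 subrr mulr0 sub0r oppr_le0.
      by rewrite !mul0r mulr0 !addr0 mulr_ge0 // sqr_ge0.
    have dd : 0 <= d <= d by rewrite lexx ltW.
    have [s1 s2 s3] := sq d z dd hz.
    have := hM _ _ s1 s3; have := hM _ _ s2 s3.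
    rewrite !ler_norml => /andP[? ?] /andP[? ?].
    have : 0 <= m * z ^+ 2 by rewrite mulr_ge0 // sqr_ge0.
    rewrite /D /B subrr !mulr0 addr0.
    have -> : m * (z ^+ 2 + d * (2 * d - d)) = m * z ^+ 2 + m * d ^+ 2 by ring.
    rewrite mE; lra.
  - move=> r hr.
    have dd : - d <= d <= d by apply/andP; split; lra.
    have dm : - d <= - d <= d by apply/andP; split; lra.
    have hB : M <= m * (d ^+ 2 + r * (2 * d - r)) + N / 2 * (r * (d - r)).
      have [r1 r2] := andP hr.
      have p1 : 0 <= m * (r * (2 * d - r)).
        by apply: mulr_ge0 => //; apply: mulr_ge0 => //; lra.
      have p2 : 0 <= N / 2 * (r * (d - r)).
        by apply: mulr_ge0; [lra|apply: mulr_ge0 => //; lra].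
      by rewrite mulrDr mE; lra.
    have [s1 s2 s3] := sq r d hr dd; have [_ _ s4] := sq r (- d) hr dm.
    have := hM _ _ s1 s3; have := hM _ _ s2 s3.
    have := hM _ _ s1 s4; have := hM _ _ s2 s4.
    rewrite !ler_norml /D /B sqrrN => /andP[? ?] /andP[? ?] /andP[? ?] /andP[? ?].
    by split; lra.
have [a1 _ _ _ _] := hv _ _ r00 z00.
have : 0 <= (2 * M / d + N * d / 2) - vr r0 z0; last by lra.
have drg := @der_right_ge0 (fun x => - D x 0) (2 * M / d + N * d / 2 - vr r0 z0) d d0.
apply: drg.
- have a1' : is_derive (r0 + 0) (1:R) (fun s => v s (z0 + 0)) (vr r0 z0) by rewrite !addr0.
  have a2' : is_derive (r0 - 0) (1:R) (fun s => v s (z0 + 0)) (vr r0 z0).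
    by rewrite subr0 addr0.
  have shp : is_derive (0:R) (1 : R) (fun s => r0 + s) 1.
    by apply: der_eq (derD (der_cst r0 _) (der_id _)) _; ring.
  have shm : is_derive (0:R) (1 : R) (fun s => r0 - s) (- 1).
    by apply: der_eq (derD (der_cst r0 _) (derN (der_id _))) _; ring.
  have p1 := der_comp (f := fun s => v s (z0 + 0)) shp a1'.
  have p2 := der_comp (f := fun s => v s (z0 + 0)) shm a2'.
  rewrite /D /B; derive_eq ltac:(eassumption).
  by rewrite /= /m; field; rewrite gt_eqF.
- by rewrite /D /B addr0 subr0 subrr; ring.
- by move=> x /andP[x0 xd]; rewrite oppr_ge0 key // !ltW.
Qed.

Lemma gradient_estimate v vr vrr vz vzz (r0 z0 d M N : R) :
  0 < d ->
  (forall r z, `|r - r0| <= d -> `|z - z0| <= d ->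
     [/\ is_derive r (1 : R) (fun s => v s z) (vr r z),
         is_derive r (1 : R) (fun s => vr s z) (vrr r z),
         is_derive z (1 : R) (fun s => v r s) (vz r z),
         is_derive z (1 : R) (fun s => vz r s) (vzz r z) &
         {for (r, z), continuous (fun y : R * R => v y.1 y.2)}]) ->
  (forall r z, `|r - r0| <= d -> `|z - z0| <= d -> `|v r z| <= M) ->
  (forall r z, `|r - r0| <= d -> `|z - z0| <= d -> `|vrr r z + vzz r z| < N) ->
  `|vr r0 z0| <= 2 * M / d + N * d / 2.
Proof.
move=> d0 hv hM hN; rewrite ler_norml; apply/andP; split; last first.
  exact: (gradient_upper d0 hv hM hN).
rewrite lerNl; apply: (@gradient_upper (fun r z => - v r z) (fun r z => - vr r z)
  (fun r z => - vrr r z) (fun r z => - vz r z) (fun r z => - vzz r z)) => //.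
- move=> r z hr hz; have [a1 a2 a3 a4 a5] := hv r z hr hz.
  by split; [exact: derN|exact: derN|exact: derN|exact: derN|exact: cvgN].
- by move=> r z hr hz; rewrite normrN; exact: hM.
- by move=> r z hr hz; rewrite -opprD normrN; exact: hN.
Qed.

End MaximumPrinciple.

(** * A divergence inequality on rectangles *)

Section Divergence.
Context {R : realType}.
Implicit Types (r z x y : R).

(** Integrating in z first, the function J(r), integral of F1(r, .), satisfies
    J' + 2 L g = integral of (div F + g) since F2 vanishes at z = L and z = - L.
    The right side is nonnegative, and at least 2 s dl while r is within s of
    r0; J vanishes at both ends, so G, a primitive of g, carries the whole
    increment. *)
Lemma divergence_inequality F1 F1r F2 F2z (G g : R -> R) (r0 z0 s dl L : R) :
  0 < L -> 0 < s -> 0 <= dl -> s <= r0 -> r0 + s <= L -> - L <= z0 - s -> z0 + s <= L ->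
  cont2 F1 -> isdr F1 F1r -> cont2 F1r -> isdz F2 F2z -> cont2 F2z ->
  (forall z, F1 0 z = 0) -> (forall z, F1 L z = 0) ->
  (forall r, F2 r (- L) = 0) -> (forall r, F2 r L = 0) ->
  (forall r : R, 0 <= r -> is_derive r (1 : R) G (g r)) ->
  (forall r z, 0 < r < L -> - L <= z <= L -> 0 <= F1r r z + F2z r z + g r) ->
  (forall r z, r0 - s < r < r0 + s -> z0 - s <= z <= z0 + s ->
     dl <= F1r r z + F2z r z + g r) ->
  4 * s ^+ 2 * dl <= 2 * L * (G L - G 0).
Proof.
move=> L0 s0 dl0 sr rL zs1 zs2 cF1 dF1 cF1r dF2 cF2z F10 F1L F2m F2L dG hpos hdl.
have LL : - L < L by lra.
pose J (r : R) := segint (- L) L (F1 r).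
pose e (r z : R) := F1r r z + F2z r z + g r.
have ce r : continuous (e r).
  move=> z; apply: cvgD; last exact: cvg_cst.
  by apply: cvgD; exact: cont2_section_z.
pose N (r : R) := J r + 2 * L * G r.
have dN r : 0 <= r -> is_derive r (1 : R) N (segint (- L) L (e r)).
  move=> r00; have dJ := segint_param (- L) L cF1 dF1 cF1r r.
  rewrite /N; derive_eq ltac:(first [exact: dJ | exact: dG]).
  rewrite /e segintD; last 2 first.
  - by move=> z; apply: cvgD; exact: cont2_section_z.
  - by move=> z; exact: cvg_cst.
  rewrite segintD; last 2 first.
  - exact: cont2_section_z.
  - exact: cont2_section_z.
  have cg : continuous (fun _ : R => g r) by move=> z; exact: cvg_cst.
  have dg x : is_derive x (1:R) (fun t => g r * t) (g r).
    by derive_eq idtac; ring.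
  rewrite (segint_derive LL (cont2_section_z cF2z) (dF2 r)) F2m F2L subrr.
  rewrite (segint_derive LL cg dg); ring.
have LLl : - L <= L by lra.
have Npos r : 0 < r -> r < L -> 0 <= segint (- L) L (e r).
  move=> r00 rL'; have hr : 0 < r < L by rewrite r00.
  have he x : - L <= x <= L -> 0 <= e r x by exact: hpos.
  have he' x : - L <= x <= - L -> 0 <= e r x.
    by case/andP=> ? ?; apply: he; apply/andP; split; lra.
  by have := segint_step (ce r) (lexx _) (lexx _) LLl (lexx 0) he he'; rewrite mul0r.
have Nbig r : r0 - s < r -> r < r0 + s -> dl * (2 * s) <= segint (- L) L (e r).
  move=> h1 h2; have hr : 0 < r < L by apply/andP; split; lra.
  have he x : - L <= x <= L -> 0 <= e r x by exact: hpos.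
  have he' x : z0 - s <= x <= z0 + s -> dl <= e r x.
    by apply: hdl; rewrite h1.
  have zz : z0 - s <= z0 + s by lra.
  have -> : 2 * s = z0 + s - (z0 - s) by ring.
  exact: (segint_step (ce r) zs1 zz zs2 dl0 he he').
have J0 r : (forall z, F1 r z = 0) -> J r = 0.
  move=> h; have -> : J r = segint (- L) L (fun=> 0).
    by congr segint; apply/funext => z; exact: h.
  have c0 : continuous (fun _ : R => 0 : R) by move=> z; exact: cvg_cst.
  rewrite (segint_derive LL c0 (fun x => der_cst 0 x)); exact: subrr.
have rs0 : 0 <= r0 - s by lra.
have i1 : 0 * (r0 - s - 0) <= N (r0 - s) - N 0.
  apply: (mean_value_ge rs0) => x h1 h2; first exact: dN.
  by apply: Npos; lra.
have i2 : dl * (2 * s) * (r0 + s - (r0 - s)) <= N (r0 + s) - N (r0 - s).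
  have rs1 : r0 - s <= r0 + s by lra.
  apply: (mean_value_ge rs1) => x h1 h2; first by apply: dN; lra.
  exact: Nbig.
have i3 : 0 * (L - (r0 + s)) <= N L - N (r0 + s).
  apply: (mean_value_ge rL) => x h1 h2; first by apply: dN; lra.
  by apply: Npos; lra.
move: i1 i2 i3; rewrite !mul0r.
have -> : dl * (2 * s) * (r0 + s - (r0 - s)) = 4 * s ^+ 2 * dl by ring.
have -> : N 0 = 2 * L * G 0 by rewrite /N J0 // add0r.
have -> : N L = 2 * L * G L by rewrite /N J0 // add0r.
by rewrite mulrBr; lra.
Qed.

End Divergence.

(** * Restriction of fields to a meridian plane *)

Section HalfPlane.
Context {R : realType}.
Implicit Types (r z s e : R) (f g : R -> R -> R).

Lemma ord3_cases (P : 'I_3 -> Prop) : P 0 -> P 1 -> P 2 -> forall i, P i.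
Proof.
move=> h0 h1 h2 [[|[|[|//]]] hi].
- by have -> : Ordinal hi = 0 by exact/val_inj.
- by have -> : Ordinal hi = 1 by exact/val_inj.
- by have -> : Ordinal hi = 2 by exact/val_inj.
Qed.

Lemma vec3_basis r z : vec3 r 0 z = r *: basis3 0 + z *: basis3 2 :> 'rV[R]_3.
Proof.
apply/rowP; apply: ord3_cases; rewrite !mxE /=.
- by rewrite mulr1 mulr0 addr0.
- by rewrite !mulr0 addr0.
- by rewrite mulr1 mulr0 add0r.
Qed.

Lemma rad_vec3 r z : Defs.rad (vec3 r 0 z) = `|r|.
Proof. by rewrite /Defs.rad !mxE /= expr0n /= addr0 sqrtr_sqr. Qed.

Lemma zcoord_vec3 r z : zcoord (vec3 r 0 z) = z.
Proof. by rewrite /zcoord mxE. Qed.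

Lemma vec3_continuous : continuous (fun y : R * R => vec3 y.1 0 y.2).
Proof.
have -> : (fun y : R * R => vec3 y.1 0 y.2) =
    (fun y => y.1 *: basis3 0 + y.2 *: basis3 2).
  by apply/funext => y; exact: vec3_basis.
by move=> [r z]; apply: cvgD; apply: cvgZr_tmp; [exact: cvg_fst|exact: cvg_snd].
Qed.

(** [l] is a coordinate of the vector velocity or the identity for the scalar
    pressure, so that both kinds of fields restrict by the same lemmas. *)
Section Trace.
Variables (W : normedModType R) (l : W -> R).
Hypothesis l_cont : continuous l.
Hypothesis l_lin : forall h x y, l (h *: (x - y)) = h * (l x - l y).

Definition trace (F : 'rV[R]_3 -> W) r z : R := l (F (vec3 r 0 z)).

Lemma trace_cont2 F : continuous F -> cont2 (trace F).
Proof.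
move=> cF y; apply: (@continuous_comp _ _ _ (fun y => F (vec3 y.1 0 y.2)) l).
  apply: (@continuous_comp _ _ _ (fun y : R * R => vec3 y.1 0 y.2) F).
    exact: vec3_continuous.
  exact: cF.
exact: l_cont.
Qed.

Lemma line_derivative (F : 'rV[R]_3 -> W) (q : R -> 'rV[R]_3) (v : 'rV[R]_3) r :
  (forall s, q s = (s - r) *: v + q r) -> derivable F (q r) v ->
  is_derive r (1 : R) (fun s => l (F (q s))) (l ('D_v F (q r))).
Proof.
move=> hq hd.
have hc : h^-1 *: (F (h *: v + q r) - F (q r)) @[h --> (0:R)^'] --> 'D_v F (q r).
  by have := hd; rewrite /derivable /derive => /cvgP.
have hl : l (h^-1 *: (F (h *: v + q r) - F (q r))) @[h --> (0:R)^'] --> l ('D_v F (q r)).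
  by apply: cvg_comp hc _; exact: l_cont.
have hl' : h^-1 *: (l (F (q (h *: (1:R) + r))) - l (F (q r))) @[h --> (0:R)^'] --> l ('D_v F (q r)).
  apply: cvg_trans hl; apply: near_eq_cvg; near=> h.
  by rewrite l_lin (hq (h *: 1 + r)) /GRing.scale /= mulr1 addrK.
split; first by apply/cvg_ex; exists (l ('D_v F (q r))).
exact: (cvg_lim _ hl').
Unshelve. all: by end_near.
Qed.

Lemma trace_isdr F : (forall x, derivable F x (basis3 0)) ->
  isdr (trace F) (trace (fun x => 'D_(basis3 0) F x)).
Proof.
move=> hF r z; apply: (@line_derivative F (fun s => vec3 s 0 z) (basis3 0)) => // s.
by rewrite !vec3_basis addrA -scalerDl subrK.
Qed.

Lemma trace_isdz F : (forall x, derivable F x (basis3 2)) ->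
  isdz (trace F) (trace (fun x => 'D_(basis3 2) F x)).
Proof.
move=> hF r z; apply: (@line_derivative F (fun s => vec3 r 0 s) (basis3 2)) => // s.
by rewrite !vec3_basis addrCA -scalerDl subrK.
Qed.

End Trace.

Record C1 f fr fz : Prop := {
  C1_cont : cont2 f;
  C1_r : isdr f fr;
  C1_z : isdz f fz;
  C1_rcont : cont2 fr;
  C1_zcont : cont2 fz }.

Record C2 f fr fz frr frz fzz : Prop := {
  C2_C1 : C1 f fr fz;
  C2_r : C1 fr frr frz;
  C2_z : C1 fz frz fzz }.

Lemma trace_C1 (W : normedModType R) (l : W -> R) F :
  continuous l -> (forall h x y, l (h *: (x - y)) = h * (l x - l y)) -> Ck 1 F ->
  C1 (trace l F) (trace l (fun x => 'D_(basis3 0) F x))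
     (trace l (fun x => 'D_(basis3 2) F x)).
Proof.
move=> lc ll [cF /= hF]; have [d0 c0] := hF 0; have [d2 c2] := hF 2.
split; try exact: trace_cont2.
- exact: trace_isdr.
- exact: trace_isdz.
Qed.

(** The mixed derivatives agree on the meridian plane by [mixed_partials], so
    one function serves for both. *)
Lemma trace_C2 (W : normedModType R) (l : W -> R) F :
  continuous l -> (forall h x y, l (h *: (x - y)) = h * (l x - l y)) -> Ck 2 F ->
  exists fr fz frr frz fzz, C2 (trace l F) fr fz frr frz fzz.
Proof.
move=> lc ll h2; have [cF hF] := h2; have [d0 c0] := hF 0; have [d2 c2] := hF 2.
have h1 : Ck 1 F.
  by split=> // i; have [di [ci _]] := hF i; split.
have t1 := trace_C1 lc ll h1; have t2 := trace_C1 lc ll c0.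
have t3 := trace_C1 lc ll c2.
have E := mixed_partials (C1_r t1) (C1_z t1) (C1_z t2) (C1_r t3) (C1_zcont t2) (C1_rcont t3).
have {}E : trace l (fun x => 'D_(basis3 2) (fun y => 'D_(basis3 0) F y) x) =
    trace l (fun x => 'D_(basis3 0) (fun y => 'D_(basis3 2) F y) x).
  by apply/funext => r; apply/funext => z; exact: E.
do 5 eexists; split; [exact: t1|exact: t2|rewrite E; exact: t3].
Qed.

Lemma dr_eq f g gr : (forall r z, 0 < r -> f r z = g r z) -> isdr g gr ->
  forall r z, 0 < r -> dr f r z = gr r z.
Proof.
move=> fg hg r z r0; apply: der_val; apply: der_near (hg r z) _.
by near=> s; rewrite fg //; near: s; exact: lt_nbhsr.
Unshelve. all: by end_near.
Qed.

Lemma dz_eq f g gz : (forall r z, 0 < r -> f r z = g r z) -> isdz g gz ->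
  forall r z, 0 < r -> dz f r z = gz r z.
Proof.
move=> fg hg r z r0; rewrite /dz.
have -> : (fun s => f r s) = (fun s => g r s) by apply/funext => s; exact: fg.
exact: der_val (hg r z).
Qed.

Lemma enorm3_ge (x : 'rV[R]_3) i : `|x 0 i| <= enorm3 x.
Proof.
rewrite -sqrtr_sqr ler_sqrt (bigD1 i) //= ?lerDl.
  by apply: sumr_ge0 => j _; exact: sqr_ge0.
by apply: addr_ge0; [exact: sqr_ge0|apply: sumr_ge0 => j _; exact: sqr_ge0].
Qed.

End HalfPlane.

(** * The Stokes stream function *)

Section Stream.
Context {R : realType}.
Implicit Types (r z s e x y : R) (f g : R -> R -> R).

Lemma cont2_r : cont2 (fun r z : R => r).
Proof. by apply: cont2_fst => ?; exact: cvg_id. Qed.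

Lemma cont2_z : cont2 (fun r z : R => z).
Proof. by apply: cont2_snd => ?; exact: cvg_id. Qed.

(** Besides the barrier B one adds e r^2, which is annihilated by the operator
    f_rr - f_r / r + f_zz and dominates S on the far sides of a large rectangle
    by the growth hypothesis; afterwards e tends to zero. *)
Lemma stream_comparison S Sr Srr Sz Szz (B B1 B2 : R -> R) (al : R) :
  0 <= al -> cont2 S -> isdr S Sr -> isdr Sr Srr -> isdz S Sz -> isdz Sz Szz ->
  (forall e, 0 < e -> exists N : R, forall r z, al <= r -> N <= r \/ N <= `|z| ->
     S r z <= e * r ^+ 2) ->
  (forall r, al < r -> is_derive r (1 : R) B (B1 r) /\ is_derive r (1 : R) B1 (B2 r)) ->
  (forall r, al <= r -> {for r, continuous B}) ->
  (forall r, al <= r -> 0 <= B r) ->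
  (forall z, S al z <= B al) ->
  (forall r z, al < r -> B2 r - B1 r / r < Srr r z - Sr r z / r + Szz r z) ->
  forall r z, al <= r -> S r z <= B r.
Proof.
move=> al0 cS dSr dSrr dSz dSzz grow dB cB B0 Bal Bstrict r z alr.
apply/ler_addgt0Pr => e e0.
have r20 : 0 < r ^+ 2 + 1 by apply: ltr_wpDl => //; exact: sqr_ge0.
pose eps := e / (r ^+ 2 + 1).
have eps0 : 0 < eps by rewrite divr_gt0.
have epsr : eps * r ^+ 2 <= e.
  by rewrite mulrAC ler_pdivrMr // mulrDr mulr1 lerDl ltW.
suff : S r z - (B r + eps * r ^+ 2) <= 0 by lra.
have [N hN] := grow eps eps0.
pose M := Num.max (Num.max N (r + 1)) (`|z| + 1).
have MN : N <= M by rewrite !le_max lexx.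
have Mr : r + 1 <= M by rewrite !le_max lexx orbT.
have Mz : `|z| + 1 <= M by rewrite le_max lexx orbT.
have nM : `|M| = M by rewrite ger0_norm //; lra.
have al2 x : 0 <= eps * x ^+ 2 by rewrite mulr_ge0 ?sqr_ge0 // ltW.
have wmp := @weak_maximum_principle R (fun r z => S r z - (B r + eps * r ^+ 2))
  (fun r z => Sr r z - (B1 r + eps * (2 * r))) (fun r z => Srr r z - (B2 r + eps * 2))
  Sz Szz (fun r z => - r^-1) al M (- M) M.
apply: (wmp _ _ _ _ r z) => {wmp}.
- move=> x y /andP[h1 h2] _; apply: cvgB; first exact: cS.
  apply: cvgD.
    apply: (@continuous_comp _ _ _ fst B (x, y)); first exact: cvg_fst.
    exact: cB.
  apply: cvgM; first exact: cvg_cst.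
  have cX : {for (x, y), continuous (fun q : R * R => q.1 ^+ 2)}.
    exact: (@cont2X R (fun r _ => r) 2 cont2_r (x, y)).
  exact: cX.
- move=> x y /andP[h1 h2] _; have [d1 d2] := dB x h1.
  split; [| | |exact: dSzz|].
  + derive_eq ltac:(first [exact: dSr|exact: d1]); by rewrite /=; ring.
  + derive_eq ltac:(first [exact: dSrr|exact: d2]); by ring.
  + by derive_eq ltac:(exact: dSz); ring.
  + have := Bstrict x y h1; have x0 : x != 0 by rewrite gt_eqF //; lra.
    have -> : - x^-1 * (Sr x y - (B1 x + eps * (2 * x))) =
      - (Sr x y / x) + B1 x / x + eps * 2 by field.
    lra.
- move=> y hy; split; first by have := Bal y; have := al2 al; lra.
  have alM : al <= M by lra.
  have := hN M y alM (or_introl MN); have := B0 M alM; lra.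
- move=> x /andP[h1 h2]; have h3 := B0 x h1.
  have hM1 : N <= `|- M| by rewrite normrN nM.
  have hM2 : N <= `|M| by rewrite nM.
  have := hN x (- M) h1 (or_intror hM1); have := hN x M h1 (or_intror hM2).
  by split; lra.
- by apply/andP; split; lra.
- by rewrite -ler_norml; lra.
Qed.

Lemma der_powR (p r : R) : 0 < r ->
  is_derive r (1 : R) (fun x => x `^ p) (p * (r `^ p / r)).
Proof.
move=> r0; apply: der_eq (is_derive1_powR p r0) _.
have -> : r `^ (p - 1) = r `^ p / r.
  have e : (p == 1) ==> (r != 0) by rewrite (gt_eqF r0) implybT.
  by rewrite (powRB e) powRr1 // ltW.
by rewrite ?mulr1.
Qed.

Variables (a ar az arr arz azz : R -> R -> R).
Variables (c cr cz crr crz czz : R -> R -> R).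
Hypothesis Ha : C2 a ar az arr arz azz.
Hypothesis Hc : C2 c cr cz crr crz czz.
Hypothesis divfree : forall r z, a r z + r * ar r z + r * cz r z = 0.

(** The substitution s = r sigma in the integral of s c(s, z) over [0, r] makes
    the domain of integration independent of r. *)
Definition stream r z := r ^+ 2 * segint 0 1 (fun s => s * c (r * s) z).

Lemma stream_axis z : stream 0 z = 0.
Proof. by rewrite /stream expr0n /= mul0r. Qed.

Lemma stream_isdr : isdr stream (fun r z => r * c r z).
Proof.
move=> r z; have [[cc dcr dcz ccr ccz] _ _] := Hc.
have c1 : cont2 (fun r s => s * c (r * s) z).
  apply: cont2M; first exact: cont2_z.
  by apply: (cont2_comp cc); [apply: cont2M; [exact: cont2_r|exact: cont2_z]|exact: cont2_cst].
have c2 : cont2 (fun r s => s * (s * cr (r * s) z)).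
  apply: cont2M; first exact: cont2_z.
  apply: cont2M; first exact: cont2_z.
  by apply: (cont2_comp ccr); [apply: cont2M; [exact: cont2_r|exact: cont2_z]|exact: cont2_cst].
have d1 : isdr (fun r s => s * c (r * s) z) (fun r s => s * (s * cr (r * s) z)).
  move=> x s; have h : is_derive x (1:R) (fun x => x * s) s by derive_eq idtac; ring.
  have hh := der_comp (f := fun q => c q z) h (dcr _ _).
  by derive_eq ltac:(exact: hh); ring.
have hI := segint_param 0 1 c1 d1 c2 r.
rewrite /stream; derive_eq ltac:(exact: hI).
rewrite /= expr1.
have i1 : segint 0 1 (fun s => 2 * (s * c (r * s) z) + r * (s * (s * cr (r * s) z))) = c r z.
  have hC : continuous (fun s => 2 * (s * c (r * s) z) + r * (s * (s * cr (r * s) z))).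
    move=> s; apply: cvgD; apply: cvgM; try exact: cvg_cst.
      exact: (cont2_section_z (r := r) c1).
    exact: (cont2_section_z (r := r) c2).
  have hD s : is_derive s (1:R) (fun s => s ^+ 2 * c (r * s) z)
      (2 * (s * c (r * s) z) + r * (s * (s * cr (r * s) z))).
    have h : is_derive s (1:R) (fun s => r * s) r by derive_eq idtac; ring.
    have hh := der_comp (f := fun q => c q z) h (dcr _ _).
    by derive_eq ltac:(exact: hh); rewrite /= expr1; ring.
  have -> := segint_derive ltr01 hC hD.
  by rewrite !mulr1 expr1n mul1r expr0n /= mul0r subr0.
have c1z := cont2_section_z (r := r) c1; have c2z := cont2_section_z (r := r) c2.
have ck (k : R) : continuous (fun _ : R => k) by move=> ?; exact: cvg_cst.
move: i1; rewrite segintD; last 2 first.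
- by move=> s; apply: cvgM; [exact: ck|exact: c1z].
- by move=> s; apply: cvgM; [exact: ck|exact: c2z].
rewrite {1}/segint RintegralZl //; last exact: continuous_integrable_segment.
rewrite {1}/segint RintegralZl //; last exact: continuous_integrable_segment.
rewrite -!/(segint _ _ _) => <-; ring.
Qed.

(** The divergence equation turns the integral of s c_z into that of the
    derivative of - s a. *)
Lemma stream_isdz : isdz stream (fun r z => - (r * a r z)).
Proof.
move=> r z; have [[cc dcr dcz ccr ccz] _ _] := Hc.
have [[ca dar _ car _] _ _] := Ha.
have c1 : cont2 (fun z s => s * c (r * s) z).
  apply: cont2M; first exact: cont2_z.
  by apply: (cont2_comp cc); [apply: cont2M; [exact: cont2_cst|exact: cont2_z]|exact: cont2_r].
have c2 : cont2 (fun z s => s * cz (r * s) z).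
  apply: cont2M; first exact: cont2_z.
  by apply: (cont2_comp ccz); [apply: cont2M; [exact: cont2_cst|exact: cont2_z]|exact: cont2_r].
have d1 : isdr (fun z s => s * c (r * s) z) (fun z s => s * cz (r * s) z).
  by move=> x s; derive_eq ltac:(exact: dcz); ring.
have hI := segint_param 0 1 c1 d1 c2 z.
rewrite /stream; derive_eq ltac:(exact: hI).
rewrite mul0r add0r.
have c2z := cont2_section_z (r := z) c2.
have i1 : segint 0 1 (fun s => r * (s * cz (r * s) z)) = - a r z.
  have hC : continuous (fun s => r * (s * cz (r * s) z)).
    by move=> s; apply: cvgM; [exact: cvg_cst|exact: c2z].
  have hD s : is_derive s (1:R) (fun s => - (s * a (r * s) z)) (r * (s * cz (r * s) z)).
    have h : is_derive s (1:R) (fun s => r * s) r by derive_eq idtac; ring.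
    have hh := der_comp (f := fun q => a q z) h (dar _ _).
    derive_eq ltac:(exact: hh); have := divfree (r * s) z; lra.
  have -> := segint_derive ltr01 hC hD.
  by rewrite !mulr1 mul1r mul0r oppr0 subr0.
move: i1; rewrite {1}/segint RintegralZl //; last exact: continuous_integrable_segment.
by rewrite -/(segint _ _ _) expr2 -mulrA => ->; rewrite mulrN.
Qed.

Lemma stream_cont2 : cont2 stream.
Proof.
apply: (partials_cont2 stream_isdr stream_isdz).
by apply: cont2M; [exact: cont2_r|exact: C1_cont (C2_C1 Hc)].
Qed.

Lemma stream_bound (m n r z : R) : 0 <= r ->
  (forall s, 0 <= s <= r -> `|s * c s z| <= m * s + n) ->
  `|stream r z| <= m * r ^+ 2 / 2 + n * r.
Proof.
move=> r0 h.
have hp s : is_derive s (1:R) (fun s => m * s ^+ 2 / 2 + n * s - stream s z) (m * s + n - s * c s z).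
  by derive_eq ltac:(exact: stream_isdr); rewrite /= expr1; field.
have hm s : is_derive s (1:R) (fun s => m * s ^+ 2 / 2 + n * s + stream s z) (m * s + n + s * c s z).
  by derive_eq ltac:(exact: stream_isdr); rewrite /= expr1; field.
have b1 : 0 * (r - 0) <= (m * r ^+ 2 / 2 + n * r - stream r z) -
    (m * 0 ^+ 2 / 2 + n * 0 - stream 0 z).
  apply: (@mean_value_ge _ (fun s => m * s ^+ 2 / 2 + n * s - stream s z)
    (fun s => m * s + n - s * c s z)) => // x h1 h2.
  have /h : 0 <= x <= r by rewrite !ltW.
  by rewrite ler_norml => /andP[]; lra.
have b2 : 0 * (r - 0) <= (m * r ^+ 2 / 2 + n * r + stream r z) -
    (m * 0 ^+ 2 / 2 + n * 0 + stream 0 z).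
  apply: (@mean_value_ge _ (fun s => m * s ^+ 2 / 2 + n * s + stream s z)
    (fun s => m * s + n + s * c s z)) => // x h1 h2.
  have /h : 0 <= x <= r by rewrite !ltW.
  by rewrite ler_norml => /andP[]; lra.
move: b1 b2; rewrite stream_axis expr0n /= => b1 b2.
by rewrite ler_norml; apply/andP; split; lra.
Qed.

End Stream.

(** * Decay of the stream function *)

Section Decay.
Context {R : realType}.
Implicit Types (r z s e x y : R) (f g : R -> R -> R).

Definition decays f := forall e, 0 < e ->
  exists M : R, forall r z, M < `|r| \/ M < `|z| -> `|f r z| <= e.

Lemma decays_bounded f : cont2 f -> decays f ->
  exists2 K : R, 0 <= K & forall r z, `|f r z| <= K.
Proof.
move=> cf df; have [M hM] := df 1 ltr01.
have [k k0 hk] := cont2_bounded (- M) M (- M) M cf.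
exists (k + 1); first by lra.
move=> r z; have [h|h] := ltP M `|r|.
  by have := hM r z (or_introl h); lra.
have [h'|h'] := ltP M `|z|; first by have := hM r z (or_intror h'); lra.
by have := hk r z; rewrite -!ler_norml => /(_ h h'); lra.
Qed.

Lemma stream_comparison_abs S Sr Srr Sz Szz (B B1 B2 : R -> R) (al : R) :
  0 <= al -> cont2 S -> isdr S Sr -> isdr Sr Srr -> isdz S Sz -> isdz Sz Szz ->
  (forall e, 0 < e -> exists N : R, forall r z, al <= r -> N <= r \/ N <= `|z| ->
     `|S r z| <= e * r ^+ 2) ->
  (forall r, al < r -> is_derive r (1 : R) B (B1 r) /\ is_derive r (1 : R) B1 (B2 r)) ->
  (forall r, al <= r -> {for r, continuous B}) ->
  (forall r, al <= r -> 0 <= B r) ->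
  (forall z, `|S al z| <= B al) ->
  (forall r z, al < r -> `|Srr r z - Sr r z / r + Szz r z| < B1 r / r - B2 r) ->
  forall r z, al <= r -> `|S r z| <= B r.
Proof.
move=> al0 cS dSr dSrr dSz dSzz grow dB cB B0 Bal Bst r z alr.
rewrite ler_norml; apply/andP; split; last first.
  apply: (stream_comparison al0 cS dSr dSrr dSz dSzz _ dB cB B0) => //.
  - move=> e e0; have [N hN] := grow e e0; exists N => x y h1 h2.
    exact: le_trans (ler_norm _) (hN x y h1 h2).
  - by move=> y; apply: le_trans (ler_norm _) (Bal y).
  - by move=> x y h1; have := Bst x y h1; rewrite ltr_norml => /andP[]; lra.
rewrite lerNl.
have dm f g : isdr f g -> isdr (fun x y => - f x y) (fun x y => - g x y).
  by move=> h x y; exact: derN (h x y).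
have dm' f g : isdz f g -> isdz (fun x y => - f x y) (fun x y => - g x y).
  by move=> h x y; exact: derN (h x y).
have sc := stream_comparison al0 (cont2N cS) (dm _ _ dSr) (dm _ _ dSrr) (dm' _ _ dSz)
  (dm' _ _ dSzz) _ dB cB B0.
apply: sc => //.
- move=> e e0; have [N hN] := grow e e0; exists N => x y h1 h2.
  by apply: le_trans (ler_norm _) _; rewrite normrN; exact: (hN x y h1 h2).
- by move=> y; apply: le_trans (ler_norm _) _; rewrite normrN; exact: Bal.
- move=> x y h1; have := Bst x y h1; rewrite ltr_norml => /andP[].
  by rewrite mulNr; lra.
Qed.

Variables (a ar az arr arz azz : R -> R -> R).
Variables (c cr cz crr crz czz : R -> R -> R).
Hypothesis Ha : C2 a ar az arr arz azz.
Hypothesis Hc : C2 c cr cz crr crz czz.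
Hypothesis divfree : forall r z, a r z + r * ar r z + r * cz r z = 0.
Hypothesis c_decays : decays c.
Local Notation S := (stream c).

Let dS := stream_isdr Hc.
Let dSz := stream_isdz Ha Hc divfree.
Let cS := stream_cont2 Ha Hc divfree.

Lemma stream_isdrr : isdr (fun r z => r * c r z) (fun r z => c r z + r * cr r z).
Proof. by move=> r z; derive_eq ltac:(exact: C1_r (C2_C1 Hc) _ _); ring. Qed.

Lemma stream_isdzz : isdz (fun r z => - (r * a r z)) (fun r z => - (r * az r z)).
Proof. by move=> r z; derive_eq ltac:(exact: C1_z (C2_C1 Ha) _ _); ring. Qed.

(** Where |z| is large c is small on the whole segment from the axis. Elsewhere
    c is small except on a bounded segment, which contributes O(r). *)
Lemma stream_growth e : 0 < e -> exists N : R, forall r z, 0 <= r ->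
  N <= r \/ N <= `|z| -> `|S r z| <= e * r ^+ 2.
Proof.
move=> e0; have [K K0 hK] := decays_bounded (C1_cont (C2_C1 Hc)) c_decays.
have [M hM] := c_decays e0; pose M' := Num.max M 0.
have M0 : 0 <= M' by rewrite le_max lexx orbT.
have MM : M <= M' by rewrite le_max lexx.
have q0 : 0 <= 2 * K * M' / e by rewrite divr_ge0 ?mulr_ge0 // ltW.
exists (M' + 1 + 2 * K * M' / e) => r z r0 [hr|hz].
  have h : `|S r z| <= e * r ^+ 2 / 2 + (K * M') * r.
    apply: (stream_bound Hc r0) => s /andP[s0 sr].
    have [Ms|sM] := ltP M s.
      have -> : `|s * c s z| = s * `|c s z| by rewrite normrM ger0_norm.
      have cs := hM s z; rewrite (ger0_norm s0) in cs.
      have := ler_wpM2l s0 (cs (or_introl Ms)).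
      have : 0 <= K * M' by rewrite mulr_ge0.
      lra.
    rewrite normrM ger0_norm //.
    have h1 : s * `|c s z| <= M' * K by apply: ler_pM => //; lra.
    have h2 : 0 <= e * s by rewrite mulr_ge0 // ltW.
    lra.
  have h3 : 2 * K * M' <= e * r.
    by rewrite [e * r]mulrC -ler_pdivrMr //; lra.
  have := ler_wpM2r r0 h3; rewrite expr2 in h *; lra.
have h : `|S r z| <= e * r ^+ 2 / 2 + 0 * r.
  apply: (stream_bound Hc r0) => s /andP[s0 sr].
  have Mz : M < `|z| by lra.
  have := ler_wpM2l s0 (hM s z (or_intror Mz)).
  rewrite normrM ger0_norm //; lra.
have : 0 <= e * r ^+ 2 by rewrite mulr_ge0 ?sqr_ge0 // ltW.
lra.
Qed.

Local Notation rho beta r := (r `^ (- beta)).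

Lemma der_rho (beta : R) r : 0 < r ->
  is_derive r (1 : R) (fun x => rho beta x) (- beta * (rho beta r / r)).
Proof. exact: der_powR. Qed.

Lemma stream_laplacian r z : 0 < r ->
  c r z + r * cr r z - r * c r z / r + - (r * az r z) = - (r * (az r z - cr r z)).
Proof. by move=> r0; field; rewrite gt_eqF. Qed.

(** The barrier is A r^(3 - beta): the operator f_rr - f_r / r + f_zz maps it to
    - A (3 - beta) (beta - 1) r^(1 - beta), and (3 - beta) (beta - 1) =
    1 - (beta - 2)^2 >= 8/9 in the range considered. *)
Lemma stream_decay (beta C : R) : 5 / 3 < beta -> beta < 2 -> 0 <= C ->
  (forall r z, 1 <= r -> `|az r z - cr r z| <= C * rho beta r) ->
  exists2 A : R, 0 <= A & forall r z, 1 <= r -> `|S r z| <= A * (r ^+ 3 * rho beta r).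
Proof.
move=> beta_lo beta_hi C_ge0 vort_theta_bound.
have [K K0 hK] := decays_bounded (C1_cont (C2_C1 Hc)) c_decays.
pose A := 2 * (C + K + 1).
have A0 : 0 <= A by rewrite /A; lra.
exists A => // r z r1.
have sca := (@stream_comparison_abs S _ _ _ _ (fun r => A * (r ^+ 3 * rho beta r))
  (fun r => A * ((3 - beta) * (r ^+ 2 * rho beta r)))
  (fun r => A * ((3 - beta) * ((2 - beta) * (r * rho beta r)))) 1 ler01 cS dS stream_isdrr dSz
  stream_isdzz).
apply: (sca _ _ _ _ _ _ r z r1) => {sca}.
- move=> e e0; have [N hN] := stream_growth e0; exists N => x y h1.
  by apply: hN; lra.
- move=> x x1; have x0 : 0 < x by lra.
  split; derive_eq ltac:(exact: (der_rho beta x0)).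
    by rewrite /=; field; rewrite gt_eqF.
  by rewrite /=; field; rewrite gt_eqF.
- move=> x x1; have x0 : 0 < x by lra.
  have : is_derive x (1 : R) (fun r => A * (r ^+ 3 * rho beta r)) (A * ((3 - beta) * (x ^+ 2 * rho beta x))).
    derive_eq ltac:(exact: (der_rho beta x0)).
    by rewrite /=; field; rewrite gt_eqF.
  exact: der_cont.
- by move=> x x1; rewrite !mulr_ge0 ?powR_ge0 ?exprn_ge0 //; lra.
- move=> y; rewrite powR1 expr1n mulr1 mulr1.
  have h : `|S 1 y| <= K * 1 ^+ 2 / 2 + 0 * 1.
    apply: (stream_bound Hc ler01) => s /andP[s0 s1].
    have := ler_wpM2l s0 (hK s y); rewrite normrM ger0_norm //; lra.
  by move: h; rewrite expr1n /A; lra.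
- move=> x y x1; have x0 : 0 < x by lra.
  rewrite stream_laplacian // normrN normrM (gtr0_norm x0).
  have hw := ler_wpM2l (ltW x0) (vort_theta_bound x y (ltW x1)).
  apply: le_lt_trans hw _.
  have -> : A * ((3 - beta) * (x ^+ 2 * rho beta x)) / x - A * ((3 - beta) * ((2 - beta) * (x * rho beta x)))
     = (A * ((3 - beta) * (beta - 1))) * (x * rho beta x) by field; rewrite gt_eqF.
  have -> : x * (C * rho beta x) = C * (x * rho beta x) by ring.
  rewrite ltr_pM2r; last by rewrite mulr_gt0 // powR_gt0.
  have h89 : 8 / 9 <= (3 - beta) * (beta - 1) by nra.
  have := ler_wpM2l A0 h89; rewrite /A; lra.
Qed.

Lemma rho_half (beta : R) r x : 0 <= beta <= 2 -> 0 < r -> r / 2 <= x -> rho beta x <= 4 * rho beta r.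
Proof.
move=> /andP[b0 b2] r0 rx; have r20 : 0 < r / 2 by lra.
have h : rho beta x <= rho beta (r / 2).
  rewrite !powRN lef_pV2 ?posrE ?powR_gt0 //; try lra.
  by apply: ge0_ler_powR; rewrite ?nnegrE; lra.
apply: le_trans h _.
have -> : rho beta (r / 2) = rho beta r * 2 `^ beta.
  rewrite powRM ?invr_ge0 //; try lra.
  by congr (_ * _); rewrite -(powR_inv1 (ler0n _ _)) -powRrM mulN1r opprK.
rewrite mulrC ler_wpM2r ?powR_ge0 //.
have -> : 4 = 2 `^ 2 :> R by rewrite -[2 in X in _ `^ X]/(2%:R) powR_mulrn //; ring.
by apply: ler_powR; lra.
Qed.

End Decay.

(** * Decay of the velocity *)

Section VelocityDecay.
Context {R : realType}.

Implicit Types (r z s e x y : R) (f g : R -> R -> R).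
Local Notation rho beta r := (r `^ (- beta)).
Variables (a ar az arr arz azz : R -> R -> R).
Variables (c cr cz crr crz czz : R -> R -> R).
Hypothesis Ha : C2 a ar az arr arz azz.
Hypothesis Hc : C2 c cr cz crr crz czz.
Hypothesis divfree : forall r z, a r z + r * ar r z + r * cz r z = 0.
Local Notation S := (stream c).

(** The function v = S / sqrt r satisfies
    v_rr + v_zz = r^(-1/2) (- r w_theta + (3/4) S / r^2). On the square of half
    side r0 / 2 around (r0, z0) all powers of r are comparable to those of r0,
    and [gradient_estimate] applies in both variables. *)
Lemma poloidal_decay (beta C A : R) : 0 <= beta <= 2 -> 0 <= C -> 0 <= A ->
  (forall r z, 1 <= r -> `|az r z - cr r z| <= C * rho beta r) ->
  (forall r z, 1 <= r -> `|S r z| <= A * (r ^+ 3 * rho beta r)) ->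
  exists2 K : R, 0 <= K & forall r z, 2 <= r ->
    `|a r z| <= K * (r * rho beta r) /\ `|c r z| <= K * (r * rho beta r).
Proof.
move=> hb C0 A0 hw hS.
have cS := stream_cont2 Ha Hc divfree.
pose K := 216 * A + 6 * (C + A + 1).
exists (K + A); first by rewrite /K; lra.
move=> r0 z0 r02.
have r00 : 0 < r0 by lra.
have r0n : r0 != 0 by rewrite gt_eqF.
pose d := r0 / 2; have d0 : 0 < d by rewrite /d; lra.
have hb2 : 0 <= (2^-1 : R) <= 2 by apply/andP; split; lra.
pose sg (r : R) := rho 2^-1 r.
have sg0 r : 0 <= sg r by exact: powR_ge0.
have sg00 : 0 < sg r0 by exact: powR_gt0.
have rho0 : 0 < rho beta r0 by exact: powR_gt0.
have inr r : `|r - r0| <= d -> [/\ 1 <= r, 0 < r, d <= r & r <= 3 / 2 * r0].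
  by rewrite ler_norml /d => /andP[? ?]; split; lra.
pose v r z := S r z * sg r.
pose vr r z := sg r * (r * c r z - S r z / (2 * r)).
pose vrr r z := sg r * (r * cr r z + 3 / 4 * (S r z / r ^+ 2)).
pose vz r z := - (r * a r z) * sg r.
pose vzz r z := - (r * az r z) * sg r.
have dv r z : 0 < r -> [/\ is_derive r (1 : R) (fun s => v s z) (vr r z),
         is_derive r (1 : R) (fun s => vr s z) (vrr r z),
         is_derive z (1 : R) (fun s => v r s) (vz r z) &
         is_derive z (1 : R) (fun s => vz r s) (vzz r z)].
  move=> rp; have dsg : is_derive r (1 : R) sg (- 2^-1 * (sg r / r)) by exact: der_rho.
  have rn : r != 0 by rewrite gt_eqF.
  have dSr := stream_isdr Hc r z.
  have dcr := C1_r (C2_C1 Hc) r z.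
  split.
  - rewrite /v /vr; derive_eq ltac:(first [exact: dSr | exact: dsg]).
    by field.
  - rewrite /vr /vrr.
    have dinv : is_derive r (1 : R) (fun s => (2 * s)^-1) (- (2 * r ^+ 2)^-1).
      have h : is_derive r (1 : R) (fun s => 2 * s) 2 by derive_eq idtac; ring.
      have n2 : 2 * r != 0 by rewrite mulf_neq0.
      by apply: der_eq (derV h n2) _; field.
    derive_eq ltac:(first [exact: dSr | exact: dsg | exact: dcr | exact: dinv]).
    by field.
  - rewrite /v /vz; derive_eq ltac:(exact: (stream_isdz Ha Hc divfree)).
    by ring.
  - rewrite /vz /vzz; derive_eq ltac:(exact: C1_z (C2_C1 Ha) _ _).
    by ring.
have cv r z : 0 < r -> {for (r, z), continuous (fun y : R * R => v y.1 y.2)}.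
  move=> rp; apply: cvgM; first exact: cS.
  apply: (@continuous_comp _ _ _ fst sg (r, z)); first exact: cvg_fst.
  exact: der_cont (der_rho 2^-1 rp).
have hM r z : `|r - r0| <= d -> `|v r z| <= 54 * A * (r0 ^+ 3 * rho beta r0 * sg r0).
  move=> /inr[r1 rp dr rr].
  have h1 := hS r z r1; have h2 := rho_half hb r00 dr.
  have h3 := rho_half hb2 r00 dr.
  have h4 : r ^+ 3 <= 27 / 8 * r0 ^+ 3.
    have -> : 27 / 8 * r0 ^+ 3 = (3 / 2 * r0) ^+ 3 by field.
    by apply: lerXn2r; rewrite ?nnegrE; lra.
  have h5 : r ^+ 3 * rho beta r <= 27 / 8 * r0 ^+ 3 * (4 * rho beta r0).
    by apply: ler_pM => //; rewrite ?exprn_ge0 ?powR_ge0 //; lra.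
  rewrite /v normrM (ger0_norm (sg0 r)).
  have h6 : `|S r z| <= A * (27 / 8 * r0 ^+ 3 * (4 * rho beta r0)).
    by apply: le_trans h1 _; apply: ler_wpM2l.
  have h7 : `|S r z| * sg r <= A * (27 / 8 * r0 ^+ 3 * (4 * rho beta r0)) * (4 * sg r0).
    by apply: ler_pM.
  apply: le_trans h7 _; apply: le_of_eq; by field.
have hN r z : `|r - r0| <= d ->
    `|vrr r z + vzz r z| < 24 * (C + A + 1) * (r0 * rho beta r0 * sg r0).
  move=> /inr[r1 rp dr rr].
  have h1 := hS r z r1; have h2 := rho_half hb r00 dr.
  have h3 := rho_half hb2 r00 dr; have h0 := hw r z r1.
  have rn : r != 0 by rewrite gt_eqF.
  have -> : vrr r z + vzz r z = sg r * (- (r * (az r z - cr r z)) + 3 / 4 * (S r z / r ^+ 2)).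
    by rewrite /vrr /vzz; ring.
  rewrite normrM (ger0_norm (sg0 r)).
  have h4 : `|- (r * (az r z - cr r z)) + 3 / 4 * (S r z / r ^+ 2)| <=
     C * (r * rho beta r) + A * (r * rho beta r).
    move: (S r z) h1 => q h1.
    apply: le_trans (ler_normD _ _) _; rewrite normrN normrM (gtr0_norm rp).
    have e1 : r * `|az r z - cr r z| <= C * (r * rho beta r).
      by rewrite mulrCA; apply: ler_wpM2l => //; exact: ltW.
    have e2 : `|q / r ^+ 2| <= A * (r * rho beta r).
      have rX : 0 < r ^+ 2 by exact: exprn_gt0.
      have r2n : `|(r ^+ 2)^-1| = (r ^+ 2)^-1 by rewrite ger0_norm // invr_ge0 ltW.
      rewrite normrM r2n ler_pdivrMr //.
      by apply: le_trans h1 _; apply: le_of_eq; ring.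
    have e3 : `|3 / 4 * (q / r ^+ 2)| <= `|q / r ^+ 2|.
      by rewrite normrM ler_piMl // ger0_norm; lra.
    by apply: lerD => //; exact: le_trans e3 e2.
  have h5 : r * rho beta r <= 3 / 2 * r0 * (4 * rho beta r0).
    by apply: ler_pM => //; rewrite ?powR_ge0 //; exact: ltW.
  have h6 : sg r * `|- (r * (az r z - cr r z)) + 3 / 4 * (S r z / r ^+ 2)| <=
      4 * sg r0 * ((C + A) * (3 / 2 * r0 * (4 * rho beta r0))).
    apply: ler_pM => //; apply: le_trans h4 _; rewrite -mulrDl.
    by apply: ler_wpM2l => //; lra.
  have h7 : 0 < r0 * rho beta r0 * sg r0 by rewrite !mulr_gt0.
  apply: le_lt_trans h6 _.
  have -> : 4 * sg r0 * ((C + A) * (3 / 2 * r0 * (4 * rho beta r0))) =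
     24 * (C + A) * (r0 * rho beta r0 * sg r0) by field.
  by rewrite ltr_pM2r //; lra.
have fin : 2 * (54 * A * (r0 ^+ 3 * rho beta r0 * sg r0)) / d +
    24 * (C + A + 1) * (r0 * rho beta r0 * sg r0) * d / 2 = K * (r0 ^+ 2 * rho beta r0) * sg r0.
  by rewrite /K /d; field.
have gr : `|vr r0 z0| <= K * (r0 ^+ 2 * rho beta r0) * sg r0.
  rewrite -fin; apply: (@gradient_estimate R v vr vrr vz vzz r0 z0 d _ _ d0).
  - move=> r z /inr[_ rp _ _] _; have [q1 q2 q3 q4] := dv r z rp.
    by split; [| | | |exact: cv].
  - by move=> r z hr _; exact: hM.
  - by move=> r z hr _; exact: hN.
have gz : `|vz r0 z0| <= K * (r0 ^+ 2 * rho beta r0) * sg r0.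
  rewrite -fin; apply: (@gradient_estimate R (fun z r => v r z) (fun z r => vz r z)
    (fun z r => vzz r z) (fun z r => vr r z) (fun z r => vrr r z) z0 r0 d _ _ d0).
  - move=> z r _ /inr[_ rp _ _]; have [q1 q2 q3 q4] := dv r z rp.
    split; [exact: q3|exact: q4|exact: q1|exact: q2|].
    by apply: (@continuous_pair_comp R v snd fst (z, r)); [exact: cvg_snd|exact: cvg_fst|exact: cv].
  - by move=> z r _ hr; exact: hM.
  - by move=> z r _ hr; rewrite addrC; exact: hN.
have rX0 : 0 < r0 ^+ 2 * rho beta r0 by rewrite mulr_gt0 // exprn_gt0.
split.
  move: gz; rewrite /vz normrM (gtr0_norm sg00) ler_pM2r // normrN normrM (gtr0_norm r00).
  have -> : K * (r0 ^+ 2 * rho beta r0) = r0 * (K * (r0 * rho beta r0)) by ring.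
  rewrite ler_pM2l // => h; apply: le_trans h _; apply: ler_wpM2r; last by lra.
  by rewrite mulr_ge0 // ltW.
move: gr; rewrite /vr normrM (gtr0_norm sg00) mulrC ler_pM2r // => h.
have hS0 : `|S r0 z0 / (2 * r0)| <= A * (r0 ^+ 2 * rho beta r0).
  have r20 : 0 < 2 * r0 by lra.
  have r01 : 1 <= r0 by lra.
  have r2n : `|(2 * r0)^-1| = (2 * r0)^-1 by rewrite ger0_norm // invr_ge0 ltW.
  rewrite normrM r2n ler_pdivrMr //.
  apply: le_trans (hS r0 z0 r01) _.
  have -> : A * (r0 ^+ 2 * rho beta r0) * (2 * r0) = A * (r0 ^+ 3 * rho beta r0) * 2 by ring.
  have : 0 <= A * (r0 ^+ 3 * rho beta r0) by rewrite !mulr_ge0 ?exprn_ge0 // ltW.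
  lra.
have : `|r0 * c r0 z0| <= r0 * ((K + A) * (r0 * rho beta r0)).
  have -> : r0 * c r0 z0 = (r0 * c r0 z0 - S r0 z0 / (2 * r0)) + S r0 z0 / (2 * r0) by ring.
  apply: le_trans (ler_normD _ _) _.
  have -> : r0 * ((K + A) * (r0 * rho beta r0)) =
    K * (r0 ^+ 2 * rho beta r0) + A * (r0 ^+ 2 * rho beta r0) by ring.
  exact: lerD.
by rewrite normrM (gtr0_norm r00) ler_pM2l.
Qed.

(** Up to a factor, r^2 r^(- beta) is a primitive of r r^(- beta), so adding a
    multiple of it to r t or to - r t gives a nondecreasing function of r. *)
Lemma swirl_decay t tr (beta C K : R) : 5 / 3 < beta -> beta < 2 -> 0 <= C -> 0 <= K ->
  isdr t tr -> (forall r z, `|t r z| <= K) ->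
  (forall r z, 1 <= r -> `|tr r z + t r z / r| <= C * rho beta r) ->
  exists2 K' : R, 0 <= K' & forall r z, 1 <= r -> `|t r z| <= K' * (r * rho beta r).
Proof.
move=> b1 b2 C0 K0 dt hK hw.
pose K' := K + C / (2 - beta).
have b20 : 0 < 2 - beta by lra.
have K'0 : 0 <= C / (2 - beta) by rewrite divr_ge0 // ltW.
exists K'; first by rewrite /K'; lra.
move=> r z r1; have r0 : 0 < r by lra.
have hW x : 1 <= x -> `|t x z + x * tr x z| <= C * (x * rho beta x).
  move=> x1; have x0 : 0 < x by lra.
  have -> : t x z + x * tr x z = x * (tr x z + t x z / x) by field; rewrite gt_eqF.
  by rewrite normrM (gtr0_norm x0) mulrCA; apply: ler_wpM2l; [exact: ltW|exact: hw].
have dcomp sgn x : 1 <= x -> is_derive x (1 : R)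
    (fun x => K' * (x ^+ 2 * rho beta x) + sgn * (x * t x z))
    (K' * (2 - beta) * (x * rho beta x) + sgn * (t x z + x * tr x z)).
  move=> x1; have x0 : 0 < x by lra.
  derive_eq ltac:(first [exact: dt | exact: (der_rho beta x0)]).
  by rewrite /=; field; rewrite gt_eqF.
have Kb : C <= K' * (2 - beta).
  by rewrite /K' mulrDl divfK ?gt_eqF // lerDr mulr_ge0 // ltW.
have key sgn : `|sgn| <= 1 -> 0 <= K' * (r ^+ 2 * rho beta r) + sgn * (r * t r z).
  move=> hs.
  have : 0 * (r - 1) <= (K' * (r ^+ 2 * rho beta r) + sgn * (r * t r z)) -
     (K' * (1 ^+ 2 * rho beta 1) + sgn * (1 * t 1 z)).
    apply: (@mean_value_ge R (fun x => K' * (x ^+ 2 * rho beta x) + sgn * (x * t x z))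
      (fun x => K' * (2 - beta) * (x * rho beta x) + sgn * (t x z + x * tr x z)) 1 r 0 r1).
      by move=> x x1 _; exact: dcomp.
    move=> x /ltW x1 _.
    have q0 : 0 <= x * rho beta x by rewrite mulr_ge0 ?powR_ge0 //; lra.
    have q1 := ler_wpM2r q0 Kb.
    have q2 : `|sgn * (t x z + x * tr x z)| <= 1 * (C * (x * rho beta x)).
      by rewrite normrM; apply: ler_pM => //; exact: hW.
    by move: q2; rewrite ler_norml => /andP[]; lra.
  have h1 : `|sgn * t 1 z| <= 1 * K by rewrite normrM; apply: ler_pM.
  move: h1; rewrite ler_norml => /andP[h1 h2].
  by rewrite powR1 expr1n !mulr1 mul1r /K'; lra.
have k1 := key 1; have k2 := key (- 1).
move: k1 k2; rewrite normrN normr1 lexx => /(_ isT) k1 /(_ isT) k2.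
have : `|r * t r z| <= r * (K' * (r * rho beta r)).
  have -> : r * (K' * (r * rho beta r)) = K' * (r ^+ 2 * rho beta r) by ring.
  by rewrite ler_norml; apply/andP; split; lra.
by rewrite normrM (gtr0_norm r0) ler_pM2l.
Qed.

End VelocityDecay.

(** * Cutoff functions and error terms *)

Section Cutoff.
Context {R : realType}.
Implicit Types (r z s L : R).
Local Notation rho beta r := (r `^ (- beta)).

Definition dome L s := 1 - s ^+ 2 / L ^+ 2.

(** The fourth power makes the first and second derivatives of the cutoff
    bounded by multiples of its own square root, which is what the absorption
    of the error terms requires. *)
Definition cutoff L s := dome L s ^+ 4.
Definition cutoff1 L s := - (8 * s / L ^+ 2 * dome L s ^+ 3).
Definition cutoff2 L s := 48 * s ^+ 2 / L ^+ 4 * dome L s ^+ 2 - 8 / L ^+ 2 * dome L s ^+ 3.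

Lemma der_dome L s : is_derive s (1 : R) (dome L) (- (2 * s / L ^+ 2)).
Proof. by rewrite /dome; derive_eq idtac; rewrite /= expr1; ring. Qed.

Lemma der_cutoff L s : is_derive s (1 : R) (cutoff L) (cutoff1 L s).
Proof.
by rewrite /cutoff /cutoff1; derive_eq ltac:(exact: der_dome); rewrite /=; ring.
Qed.

Lemma der_cutoff1 L s : L != 0 -> is_derive s (1 : R) (cutoff1 L) (cutoff2 L s).
Proof.
move=> L0; rewrite /cutoff1 /cutoff2; derive_eq ltac:(exact: der_dome).
by rewrite /=; field.
Qed.

Lemma dome_itv L s : 0 < L -> `|s| <= L -> 0 <= dome L s <= 1.
Proof.
move=> L0 sL; have L2 : 0 < L ^+ 2 by exact: exprn_gt0.
have h : s ^+ 2 <= L ^+ 2 by rewrite -(real_normK (num_real s)) lerXn2r ?nnegrE // ltW.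
have h1 : s ^+ 2 / L ^+ 2 <= 1 by rewrite ler_pdivrMr // mul1r.
have h2 : 0 <= s ^+ 2 / L ^+ 2 by rewrite divr_ge0 ?sqr_ge0 // ltW.
by rewrite /dome; apply/andP; split; lra.
Qed.

Lemma dome_edge L s : L != 0 -> s ^+ 2 = L ^+ 2 -> dome L s = 0.
Proof. by move=> L0 h; rewrite /dome h divff ?subrr // expf_neq0. Qed.

Lemma cutoff1_bound L s : 0 < L -> `|s| <= L -> `|cutoff1 L s| <= 8 / L * dome L s ^+ 2.
Proof.
move=> L0 sL; have /andP[b0 b1] := dome_itv L0 sL.
have Ln : L != 0 by rewrite gt_eqF.
have -> : cutoff1 L s = - (8 / L * (s / L) * (dome L s ^+ 2 * dome L s)).
  by rewrite /cutoff1; field.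
have h2 : 0 <= 8 / L by rewrite divr_ge0 // ltW.
have h3 : 0 <= dome L s ^+ 2 by exact: sqr_ge0.
have Li : `|L^-1| = L^-1 by rewrite ger0_norm // invr_ge0 ltW.
have hb : 0 <= dome L s ^+ 2 * dome L s by rewrite mulr_ge0.
rewrite normrN normrM (normrM (8 / L)) (normrM s) Li (ger0_norm h2) (ger0_norm hb).
have h1 : `|s| / L <= 1 by rewrite ler_pdivrMr // mul1r.
have h0 : 0 <= `|s| / L by rewrite divr_ge0 // ltW.
have h4 : dome L s ^+ 2 * dome L s <= dome L s ^+ 2 by rewrite ler_piMr.
have h5 : 8 / L * (`|s| / L) <= 8 / L by rewrite ler_piMr.
by apply: ler_pM => //; rewrite mulr_ge0.
Qed.

(** The square root of the cutoff in (r, z). *)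
Definition weight L r z := dome L r ^+ 2 * dome L z ^+ 2.

Lemma weight_itv L r z : 0 < L -> `|r| <= L -> `|z| <= L -> 0 <= weight L r z <= 1.
Proof.
move=> L0 rL zL; have /andP[r0 r1] := dome_itv L0 rL; have /andP[z0 z1] := dome_itv L0 zL.
by rewrite /weight mulr_ge0 ?sqr_ge0 // mulr_ile1 ?sqr_ge0 // expr_le1.
Qed.

Lemma cutoff_weight L r z : cutoff L r * cutoff L z = weight L r z ^+ 2.
Proof. by rewrite /cutoff /weight; ring. Qed.

Lemma cutoff_sq L s : 0 < L -> `|s| <= L -> 0 <= cutoff L s <= dome L s ^+ 2.
Proof.
move=> L0 sL; have /andP[b0 b1] := dome_itv L0 sL.
rewrite /cutoff (exprD _ 2 2) mulr_ge0 ?sqr_ge0 //=.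
by rewrite ler_piMr ?sqr_ge0 // expr_le1.
Qed.

Lemma cutoff_gradient L r z : 0 < L -> `|r| <= L -> `|z| <= L ->
  `|cutoff1 L r * cutoff L z| <= 8 / L * weight L r z /\
  `|cutoff L r * cutoff1 L z| <= 8 / L * weight L r z.
Proof.
move=> L0 rL zL.
have /andP[c0 c1] := cutoff_sq L0 zL; have /andP[d0 d1] := cutoff_sq L0 rL.
have h1 := cutoff1_bound L0 rL; have h2 := cutoff1_bound L0 zL.
rewrite /weight; split; rewrite normrM.
  by rewrite mulrA; apply: ler_pM => //; rewrite ger0_norm.
by rewrite mulrCA; apply: ler_pM => //; rewrite ger0_norm.
Qed.

Lemma cutoff_laplacian L r z : 0 < L -> 0 < r -> `|r| <= L -> `|z| <= L ->
  `|(cutoff2 L r - cutoff1 L r / r) * cutoff L z + cutoff L r * cutoff2 L z|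
    <= 96 / L ^+ 2 * weight L r z.
Proof.
move=> L0 r0 rL zL.
have Ln : L != 0 by rewrite gt_eqF.
have L2 : 0 <= (L ^+ 2)^-1 by rewrite invr_ge0 exprn_ge0 // ltW.
have /andP[c0 c1] := cutoff_sq L0 zL; have /andP[d0 d1] := cutoff_sq L0 rL.
have /andP[b0 b1] := dome_itv L0 zL.
have sq_le s : `|s| <= L -> 0 <= s ^+ 2 / L ^+ 2 <= 1.
  by move=> /(dome_itv L0); rewrite /dome => /andP[? ?]; apply/andP; split; lra.
have /andP[p0 p1] := sq_le r rL; have /andP[q0 q1] := sq_le z zL.
have -> : cutoff2 L r - cutoff1 L r / r = 48 * (r ^+ 2 / L ^+ 2) * (L ^+ 2)^-1 * dome L r ^+ 2.
  by rewrite /cutoff1 /cutoff2; field; rewrite Ln gt_eqF.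
have -> : cutoff2 L z = (48 * (z ^+ 2 / L ^+ 2) - 8 * dome L z) * (L ^+ 2)^-1 * dome L z ^+ 2.
  by rewrite /cutoff2; field.
have -> : 96 / L ^+ 2 * weight L r z =
    48 * (L ^+ 2)^-1 * dome L r ^+ 2 * dome L z ^+ 2 +
    dome L r ^+ 2 * (48 * (L ^+ 2)^-1 * dome L z ^+ 2) by rewrite /weight; field.
have sr := sqr_ge0 (dome L r); have sz := sqr_ge0 (dome L z).
apply: le_trans (ler_normD _ _) _; apply: lerD; rewrite normrM; apply: ler_pM => //.
- rewrite ger0_norm.
    apply: ler_wpM2r => //; apply: ler_wpM2r => //; lra.
  by apply: mulr_ge0 => //; apply: mulr_ge0 => //; lra.
- by rewrite ger0_norm.
- by rewrite ger0_norm.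
- rewrite normrM [`|dome L z ^+ 2|]ger0_norm //; apply: ler_wpM2r => //.
  rewrite normrM [`|(L ^+ 2)^-1|]ger0_norm //; apply: ler_wpM2r => //.
  by rewrite ler_norml; apply/andP; split; lra.
Qed.

(** The error terms of the enstrophy balance: w bounds the three components of
    the vorticity, V those of the velocity, s the stream function, Ph the first
    derivatives of the cutoff (X in r, Y in z) and De the operator
    f_rr - f_r / r + f_zz applied to the cutoff. *)
Lemma error_bound (wth tz wz a c t S X Y D w V s Ph De r : R) : 0 <= r ->
  `|wth| <= w -> `|tz| <= w -> `|wz| <= w ->
  `|a| <= V -> `|c| <= V -> `|t| <= V -> `|S| <= s ->
  `|X| <= Ph -> `|Y| <= Ph -> `|D| <= De ->
  wth * (2 * (X * (r * c) - Y * (r * a)) + S * D)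
   - tz * r * Y * t - r * wz * t * X
   + (wth * c - wz * t) * S * Y + (tz * t + wth * a) * S * X
  <= w * (6 * (r * V * Ph) + 4 * (V * s * Ph) + s * De).
Proof.
move=> r0 h1 h2 h3 h4 h5 h6 h7 h8 h9 h10.
have b2 x y p q : `|x| <= p -> `|y| <= q -> `|x * y| <= p * q :> R.
  by move=> hx hy; rewrite normrM; exact: ler_pM.
have u x p : `|x| <= p -> x <= p :> R by exact: le_trans (ler_norm x).
have u' x p : `|x| <= p -> - x <= p :> R.
  by move=> h; apply: le_trans h; rewrite -normrN; exact: ler_norm.
have hr : `|r| <= r by rewrite ger0_norm.
have t1 := u _ _ (b2 _ _ _ _ h1 (b2 _ _ _ _ h8 (b2 _ _ _ _ hr h5))).
have t2 := u' _ _ (b2 _ _ _ _ h1 (b2 _ _ _ _ h9 (b2 _ _ _ _ hr h4))).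
have t3 := u _ _ (b2 _ _ _ _ h1 (b2 _ _ _ _ h7 h10)).
have t4 := u' _ _ (b2 _ _ _ _ h2 (b2 _ _ _ _ h9 (b2 _ _ _ _ hr h6))).
have t5 := u' _ _ (b2 _ _ _ _ h3 (b2 _ _ _ _ h8 (b2 _ _ _ _ hr h6))).
have t6 := u _ _ (b2 _ _ _ _ h1 (b2 _ _ _ _ h5 (b2 _ _ _ _ h7 h9))).
have t7 := u' _ _ (b2 _ _ _ _ h3 (b2 _ _ _ _ h6 (b2 _ _ _ _ h7 h9))).
have t8 := u _ _ (b2 _ _ _ _ h2 (b2 _ _ _ _ h6 (b2 _ _ _ _ h7 h8))).
have t9 := u _ _ (b2 _ _ _ _ h1 (b2 _ _ _ _ h4 (b2 _ _ _ _ h7 h8))).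
clear -t1 t2 t3 t4 t5 t6 t7 t8 t9; lra.
Qed.

(** Since S = O(r^2) and the velocity is bounded, the error is at most
    r (w q) (Y / L) with Y depending on M and K only; then
    2 x y <= x^2 + y^2. *)
Lemma error_near (w q V s r L M K : R) : 1 <= L -> 0 < r -> r <= M -> 0 <= K ->
  0 <= w -> 0 <= q -> V <= K -> 0 <= V -> 0 <= s -> s <= K * r ^+ 2 ->
  w * (6 * (r * V * (8 / L * q)) + 4 * (V * s * (8 / L * q)) + s * (96 / L ^+ 2 * q)) <=
  2^-1 * r * (q ^+ 2 * w ^+ 2) +
  2^-1 * M * (48 * K + 32 * K ^+ 2 * M + 96 * K * M) ^+ 2 / L ^+ 2.
Proof.
move=> L1 r0 rM K0 w0 q0 VK V0 s0 sK.
have L0 : 0 < L by lra.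
have Ln : L != 0 by rewrite gt_eqF.
have Li : 0 <= L^-1 by rewrite invr_ge0 ltW.
have Li1 : L^-1 <= 1 by rewrite invf_le1.
have M0 : 0 <= M by lra.
pose Y := 48 * K + 32 * K ^+ 2 * M + 96 * K * M.
have rM2 : r ^+ 2 <= r * M by rewrite expr2 ler_wpM2l // ltW.
have sK' : s <= r * (K * M).
  apply: le_trans sK _; have -> : r * (K * M) = K * (r * M) by ring.
  exact: ler_wpM2l.
have h1 : r * V <= r * K by rewrite ler_wpM2l // ltW.
have h2 : V * s <= K * (r * (K * M)) by apply: ler_pM.
have h3 : s * L^-1 <= r * (K * M) by apply: le_trans sK'; rewrite ler_piMr.
have Z : 48 * (r * V) + 32 * (V * s) + 96 * (s * L^-1) <= r * Y.
  have -> : r * Y = 48 * (r * K) + 32 * (K * (r * (K * M))) + 96 * (r * (K * M)).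
    by rewrite /Y; ring.
  lra.
have wq : 0 <= w * q * L^-1 by rewrite !mulr_ge0.
have := ler_wpM2l wq Z.
have -> : w * q * L^-1 * (48 * (r * V) + 32 * (V * s) + 96 * (s * L^-1)) =
  w * (6 * (r * V * (8 / L * q)) + 4 * (V * s * (8 / L * q)) + s * (96 / L ^+ 2 * q)) by field.
move=> h; apply: le_trans h _.
have yo : w * q * (Y / L) <= 2^-1 * (q ^+ 2 * w ^+ 2) + 2^-1 * (Y / L) ^+ 2.
  have := sqr_ge0 (w * q - Y / L); rewrite sqrrB exprMn; lra.
have := ler_wpM2l (ltW r0) yo.
have -> : r * (w * q * (Y / L)) = w * q * L^-1 * (r * Y) by ring.
move=> h; apply: le_trans h _.
rewrite mulrDr; apply: lerD; first by apply: le_of_eq; ring.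
have -> : 2^-1 * M * Y ^+ 2 / L ^+ 2 = M * (2^-1 * (Y / L) ^+ 2) by field.
by apply: ler_wpM2r => //; rewrite mulr_ge0 ?sqr_ge0.
Qed.

(** Each term carries at most the powers r^4 p^3, with p = r^(- beta): the
    linear terms carry r^2 p^2, which is smaller as r^2 p >= 1, and the second
    derivatives of the cutoff trade a factor r for a factor L. *)
Lemma error_far (w q V s r L p C K A : R) : 0 < r -> r <= L -> 0 < p -> 1 <= r ^+ 2 * p ->
  0 <= C -> 0 <= K -> 0 <= A ->
  0 <= w -> w <= C * p -> 0 <= q -> q <= 1 -> 0 <= V -> V <= K * (r * p) ->
  0 <= s -> s <= A * (r ^+ 3 * p) ->
  w * (6 * (r * V * (8 / L * q)) + 4 * (V * s * (8 / L * q)) + s * (96 / L ^+ 2 * q)) <=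
  C * (48 * K + 32 * K * A + 96 * A) * (r ^+ 4 * p ^+ 3) / L.
Proof.
move=> r0 rL p0 rp C0 K0 A0 w0 wC q0 q1 V0 VK s0 sA.
have L0 : 0 < L by lra.
have Ln : L != 0 by rewrite gt_eqF.
have Li : 0 <= L^-1 by rewrite invr_ge0 ltW.
have h1 : r * V <= K * (r ^+ 2 * p).
  have -> : K * (r ^+ 2 * p) = r * (K * (r * p)) by ring.
  by rewrite ler_wpM2l // ltW.
have h2 : V * s <= K * A * (r ^+ 4 * p ^+ 2).
  have -> : K * A * (r ^+ 4 * p ^+ 2) = K * (r * p) * (A * (r ^+ 3 * p)) by ring.
  exact: ler_pM.
have h3 : s * L^-1 <= A * (r ^+ 2 * p).
  rewrite ler_pdivrMr //; apply: le_trans sA _.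
  have -> : A * (r ^+ 3 * p) = A * (r ^+ 2 * p) * r by ring.
  by rewrite ler_wpM2l // !mulr_ge0 ?sqr_ge0 // ltW.
have rp0 : 0 <= r ^+ 2 * p by lra.
have h4 : r ^+ 2 * p <= r ^+ 4 * p ^+ 2.
  have -> : r ^+ 4 * p ^+ 2 = (r ^+ 2 * p) * (r ^+ 2 * p) by ring.
  by rewrite ler_peMl.
have Z : 48 * (r * V) + 32 * (V * s) + 96 * (s * L^-1) <=
    (48 * K + 32 * K * A + 96 * A) * (r ^+ 4 * p ^+ 2).
  have h5 := ler_wpM2l K0 h4; have h6 := ler_wpM2l A0 h4; lra.
have Z0 : 0 <= 48 * (r * V) + 32 * (V * s) + 96 * (s * L^-1).
  have : 0 <= r * V by rewrite mulr_ge0 // ltW.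
  have : 0 <= V * s by rewrite mulr_ge0.
  have : 0 <= s * L^-1 by rewrite mulr_ge0.
  lra.
have wq : w * q <= C * p.
  by apply: le_trans wC; rewrite ler_piMr.
have wq0 : 0 <= w * q by rewrite mulr_ge0.
have h := ler_pM wq0 Z0 wq Z.
have := ler_wpM2r Li h.
have -> : w * q * (48 * (r * V) + 32 * (V * s) + 96 * (s * L^-1)) * L^-1 =
  w * (6 * (r * V * (8 / L * q)) + 4 * (V * s * (8 / L * q)) + s * (96 / L ^+ 2 * q)) by field.
move=> h'; apply: le_trans h' _; apply: le_of_eq; by field.
Qed.

End Cutoff.

Section Tail.
Context {R : realType}.
Implicit Types (r z s L x y M : R).
Local Notation rho beta r := (r `^ (- beta)).

Lemma rho_anti (p x y : R) : 0 <= p -> 0 < x -> x <= y -> rho p y <= rho p x.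
Proof.
move=> p0 x0 xy; rewrite !powRN lef_pV2 ?posrE ?powR_gt0 //; try lra.
by apply: ge0_ler_powR; rewrite ?nnegrE; lra.
Qed.

(** Up to a constant factor, the derivative of (1 + r)^(- p), hence integrable
    on the half line. *)
Definition tail (p r : R) := rho p (1 + r) / (1 + r).

Lemma tail_gt0 (p r : R) : 0 <= r -> 0 < tail p r.
Proof. by move=> r0; rewrite divr_gt0 ?powR_gt0; lra. Qed.

Lemma tail_anti (p x y : R) : 0 <= p -> 0 <= x -> x <= y -> tail p y <= tail p x.
Proof.
move=> p0 x0 xy; apply: ler_pM.
- exact: powR_ge0.
- by rewrite invr_ge0; lra.
- by apply: rho_anti; lra.
- by rewrite lef_pV2 ?posrE; lra.
Qed.

Lemma tail_primitive (p k r : R) : 0 < p -> 0 <= r ->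
  is_derive r (1 : R) (fun x => - (k / p) * rho p (1 + x)) (k * tail p r).
Proof.
move=> p0 r0; have r1 : 0 < 1 + r by lra.
have sh : is_derive r (1 : R) (fun x => 1 + x) 1 by derive_eq idtac; ring.
have dr := der_comp (f := fun x => rho p x) sh (der_rho p r1).
rewrite /tail; derive_eq ltac:(exact: dr).
by field; rewrite !gt_eqF.
Qed.

Lemma rho_small (p D eta : R) : 0 < p -> 0 <= D -> 0 < eta ->
  exists2 M : R, 2 <= M & 8 * D * rho p M <= eta.
Proof.
move=> p0 D0 eta0; pose B := 8 * D / eta + 1.
have q0 : 0 <= 8 * D / eta by rewrite divr_ge0; lra.
have B0 : 0 < B by rewrite /B; lra.
pose M := Num.max 2 (B `^ (p^-1)).
have M2 : 2 <= M by rewrite le_max lexx.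
exists M => //.
have BM : B `^ (p^-1) <= M by rewrite le_max lexx orbT.
have MB : B <= M `^ p.
  have -> : B = (B `^ (p^-1)) `^ p by rewrite -powRrM mulVf ?gt_eqF // powRr1 // ltW.
  have p1 : 0 <= p by lra.
  have M0 : 0 <= M by lra.
  exact: (ge0_ler_powR p1 (powR_ge0 _ _) M0 BM).
have Mp : 0 < M `^ p by apply: powR_gt0; lra.
rewrite powRN ler_pdivrMr //.
have h : 8 * D <= eta * B.
  have -> : eta * B = 8 * D + eta by rewrite /B; field; rewrite gt_eqF.
  lra.
by apply: le_trans h _; rewrite ler_pM2l.
Qed.

(** With 2 p = 3 beta - 5 one has r^4 r^(- 3 beta) = r^(- p) r^(- p) / r: one
    factor r^(- p) is small for r >= M and the other leaves an integrable
    tail. *)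
Lemma far_field_tail (beta D eta M r : R) : 5 / 3 < beta -> beta < 2 -> 0 <= D ->
  2 <= M -> M <= r -> 8 * D * rho ((3 * beta - 5) / 2) M <= eta ->
  D * (r ^+ 4 * rho beta r ^+ 3) <= eta * tail ((3 * beta - 5) / 2) r.
Proof.
move=> b1 b2 D0 M2 Mr DM; set p := (3 * beta - 5) / 2 in DM *.
have p0 : 0 < p by rewrite /p; lra.
have r0 : 0 < r by lra.
have rn : r != 0 by rewrite gt_eqF.
have -> : r ^+ 4 * rho beta r ^+ 3 = rho p r * (rho p r / r).
  apply: (mulIf rn).
  have -> : rho p r * (rho p r / r) * r = rho p r * rho p r by field.
  have -> : r ^+ 4 * rho beta r ^+ 3 * r = r ^+ 5 * rho beta r ^+ 3 by ring.
  have imp x : (x == 0) ==> (r != 0) by rewrite rn implybT.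
  rewrite -(powR_mulrn 5 (ltW r0)) -(powR_mulrn 3 (powR_ge0 _ _)) -powRrM.
  by rewrite -!powRD ?imp //; congr (_ `^ _); rewrite /p; field.
have j1 : rho p r <= rho p M by apply: rho_anti; lra.
have j2 : rho p r / r <= 8 * tail p r.
  have i1 : rho p r <= 4 * rho p (1 + r).
    by apply: rho_half; [apply/andP; split; rewrite /p; lra|lra|lra].
  have i2 : r^-1 <= 2 / (1 + r).
    have r1 : 0 < 1 + r by lra.
    by rewrite ler_pdivlMr // mulrC ler_pdivrMr //; lra.
  have -> : 8 * tail p r = 4 * rho p (1 + r) * (2 / (1 + r)) by rewrite /tail; ring.
  by apply: ler_pM => //; [exact: powR_ge0|rewrite invr_ge0 ltW].
have j3 : rho p r * (rho p r / r) <= rho p M * (8 * tail p r).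
  apply: ler_pM => //; first exact: powR_ge0.
  by rewrite mulr_ge0 ?powR_ge0 // invr_ge0 ltW.
have j4 := ler_wpM2l D0 j3.
have j5 := ler_wpM2r (ltW (tail_gt0 p (ltW r0))) DM.
lra.
Qed.

End Tail.

(** * The enstrophy balance and the vanishing of the vorticity *)

Section Algebra.
Context {R : realType}.

(** Pointwise form of the tested equations. A0, A1, A2 stand for the radial
    cutoff and its first two derivatives, B0, B1, B2 for the axial ones, and
    test_r, test_z, Hrr, ... for the derivatives of the cutoff times S. The
    momentum equations express Pr, Pz and trr, and the divergence equation with
    its two derivatives expresses cz, crz and czz; after substitution the
    identity is one of rational functions. *)
Lemma energy_identity_algebra (r a ar az arr arz azz t tr tz trr tzz c cr cz crr crz czz
    P Pr Pz S A0 A1 A2 B0 B1 B2 : R) : r != 0 ->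
  a * ar + c * az - (arr + r^-1 * ar + azz) + a / r ^+ 2 - t ^+ 2 / r + Pr = 0 ->
  a * tr + c * tz - (trr + r^-1 * tr + tzz) + t / r ^+ 2 + a * t / r = 0 ->
  a * cr + c * cz - (crr + r^-1 * cr + czz) + Pz = 0 ->
  a + r * ar + r * cz = 0 ->
  2 * ar + r * arr + cz + r * crz = 0 ->
  az + r * arz + r * czz = 0 ->
  let Q := P + 2^-1 * (a ^+ 2 + t ^+ 2 + c ^+ 2) in
  let Qr := Pr + (a * ar + t * tr + c * cr) in
  let Qz := Pz + (a * az + t * tz + c * cz) in
  let wth := az - cr in
  let W := t + r * tr in
  let test_r := A1 * B0 * S + A0 * B0 * (r * c) in
  let test_z := A0 * B1 * S - A0 * B0 * (r * a) in
  let Hrr := A2 * B0 * S + 2 * (A1 * B0 * (r * c)) + A0 * B0 * (c + r * cr) in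
  let Hzr := A1 * B1 * S + A0 * B1 * (r * c) - A1 * B0 * (r * a) - A0 * B0 * (a + r * ar) in
  let Hrz := A1 * B1 * S - A1 * B0 * (r * a) + A0 * B1 * (r * c) + A0 * B0 * (r * cz) in
  let Hzz := A0 * B2 * S - 2 * (A0 * B1 * (r * a)) - A0 * B0 * (r * az) in
  r * (A0 * B0) * (tz ^+ 2 + wth ^+ 2 + (W / r) ^+ 2) =
  (Qr * test_z + Q * Hzr - ((arz - crr) * test_r + wth * Hrr) +
    ((2 * tr + r * trr) * (A0 * B0 * t) + W * (A1 * B0 * t + A0 * B0 * tr))) +
  (- (Qz * test_r + Q * Hrz) - ((azz - crz) * test_z + wth * Hzz) +
    r * (tzz * (A0 * B0 * t) + tz * (A0 * B1 * t + A0 * B0 * tz))) +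
  (wth * (2 * (A1 * B0 * (r * c) - A0 * B1 * (r * a)) + S * ((A2 - A1 / r) * B0 + A0 * B2))
   - tz * r * (A0 * B1) * t - W * t * (A1 * B0)
   + (wth * c - W / r * t) * S * (A0 * B1) + (tz * t + wth * a) * S * (A1 * B0)).
Proof.
move=> r0 E1 E2 E3 E4 E5 E6 /=.
have e4 : cz = - ar - a / r.
  by apply: (mulfI r0); rewrite mulrBr mulrCA divff // mulr1; lra.
have e5 : crz = - arr - ar / r + a / r ^+ 2.
  apply: (mulfI r0); have -> : r * crz = - (2 * ar) - r * arr - cz by lra.
  by rewrite e4; field.
have e6 : czz = - arz - az / r.
  by apply: (mulfI r0); rewrite mulrBr mulrCA divff // mulr1; lra.
have e1 : Pr = - (a * ar + c * az - (arr + r^-1 * ar + azz) + a / r ^+ 2 - t ^+ 2 / r) by lra.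
have e2 : trr = a * tr + c * tz - (r^-1 * tr + tzz) + t / r ^+ 2 + a * t / r by lra.
have e3 : Pz = - (a * cr + c * cz - (crr + r^-1 * cr + czz)) by lra.
clear E1 E2 E3 E4 E5 E6.
rewrite e1 e2 e3 e5 e6 e4; field.
exact: r0.
Qed.

End Algebra.

Ltac cont2_with tac :=
  lazymatch goal with
  | |- cont2 (fun _ _ => ?k) => apply: cont2_cst
  | |- cont2 (fun r _ => r) => apply: cont2_r
  | |- cont2 (fun _ z => z) => apply: cont2_z
  | |- cont2 (fun r z => @Algebra.add _ (@?f r z) (@?g r z)) =>
      apply (@cont2D _ f g); cont2_with tac
  | |- cont2 (fun r z => @Algebra.opp _ (@?f r z)) => apply (@cont2N _ f); cont2_with tac
  | |- cont2 (fun r z => @GRing.mul _ (@?f r z) (@?g r z)) =>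
      apply (@cont2M _ f g); cont2_with tac
  | |- cont2 (fun r z => @GRing.exp _ (@?f r z) ?n) => apply (@cont2X _ f n); cont2_with tac
  | |- _ => tac
  end.

(* The hypothesis is selected syntactically: unification up to conversion could
   unfold the functions involved. *)
Ltac cont2_atom :=
  lazymatch goal with
  | H : cont2 ?f |- cont2 (fun r z => ?f r z) => exact H
  | H : cont2 ?f |- cont2 ?f => exact H
  end.

(** Throughout this part a, t and c are the radial, azimuthal and axial
    components of the velocity in the meridian plane, P is the pressure, and
    the suffixes r and z denote partial derivatives. *)
Section Energy.
Context {R : realType}.
Implicit Types (r z s L : R).
Local Notation rho beta r := (r `^ (- beta)).
Variables (a ar az arr arz azz : R -> R -> R).
Variables (t tr tz trr trz tzz : R -> R -> R).
Variables (c cr cz crr crz czz : R -> R -> R).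
Variables (P Pr Pz : R -> R -> R).
Hypothesis Ha : C2 a ar az arr arz azz.
Hypothesis Ht : C2 t tr tz trr trz tzz.
Hypothesis Hc : C2 c cr cz crr crz czz.
Hypothesis HP : C1 P Pr Pz.
Hypothesis t_axis : forall z, t 0 z = 0.
Hypothesis divfree : forall r z, a r z + r * ar r z + r * cz r z = 0.
Hypothesis momentum_r : forall r z, 0 < r ->
  a r z * ar r z + c r z * az r z - (arr r z + r^-1 * ar r z + azz r z)
    + a r z / r ^+ 2 - t r z ^+ 2 / r + Pr r z = 0.
Hypothesis momentum_theta : forall r z, 0 < r ->
  a r z * tr r z + c r z * tz r z - (trr r z + r^-1 * tr r z + tzz r z)
    + t r z / r ^+ 2 + a r z * t r z / r = 0.
Hypothesis momentum_z : forall r z, 0 < r ->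
  a r z * cr r z + c r z * cz r z - (crr r z + r^-1 * cr r z + czz r z) + Pz r z = 0.
Local Notation S := (stream c).

Lemma divfree_r r z : 2 * ar r z + r * arr r z + cz r z + r * crz r z = 0.
Proof.
have d := C1_r (C2_C1 Ha); have d1 := C1_r (C2_r Ha); have d2 := C1_r (C2_z Hc).
have h : is_derive r (1 : R) (fun r => a r z + r * ar r z + r * cz r z)
    (2 * ar r z + r * arr r z + cz r z + r * crz r z).
  by derive_eq ltac:(first [exact: d | exact: d1 | exact: d2]); ring.
have h0 : is_derive r (1 : R) (fun r => a r z + r * ar r z + r * cz r z) 0.
  rewrite (_ : (fun _ => _) = fun=> 0); first exact: der_cst.
  by apply/funext => x; exact: divfree.
exact: der_unique h h0.
Qed.

Lemma divfree_z r z : az r z + r * arz r z + r * czz r z = 0.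
Proof.
have d := C1_z (C2_C1 Ha); have d1 := C1_z (C2_r Ha); have d2 := C1_z (C2_z Hc).
have h : is_derive z (1 : R) (fun z => a r z + r * ar r z + r * cz r z)
    (az r z + r * arz r z + r * czz r z).
  by derive_eq ltac:(first [exact: d | exact: d1 | exact: d2]); ring.
have h0 : is_derive z (1 : R) (fun z => a r z + r * ar r z + r * cz r z) 0.
  rewrite (_ : (fun _ => _) = fun=> 0); first exact: der_cst.
  by apply/funext => x; exact: divfree.
exact: der_unique h h0.
Qed.

Definition head_pressure r z := P r z + 2^-1 * (a r z ^+ 2 + t r z ^+ 2 + c r z ^+ 2).
Definition vort_th r z := az r z - cr r z.

(** r times the axial vorticity, which is smooth up to the axis. *)
Definition r_vort_z r z := t r z + r * tr r z.
Definition test_r L r z :=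
  cutoff1 L r * cutoff L z * S r z + cutoff L r * cutoff L z * (r * c r z).
Definition test_z L r z :=
  cutoff L r * cutoff1 L z * S r z - cutoff L r * cutoff L z * (r * a r z).

(** The fluxes come from integrating by parts the product of the momentum
    equations with the test field ([- test_z], [r] times cutoff times [t],
    [test_r]). *)
Definition flux_r L r z :=
  head_pressure r z * test_z L r z - vort_th r z * test_r L r z
  + r_vort_z r z * (cutoff L r * cutoff L z * t r z).
Definition flux_z L r z :=
  - (head_pressure r z * test_r L r z) - vort_th r z * test_z L r z
  + r * (tz r z * (cutoff L r * cutoff L z * t r z)).

Definition flux_r_r L r z :=
  (Pr r z + (a r z * ar r z + t r z * tr r z + c r z * cr r z)) * test_z L r z
  + head_pressure r z * (cutoff1 L r * cutoff1 L z * S r z + cutoff L r * cutoff1 L z * (r * c r z)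
     - cutoff1 L r * cutoff L z * (r * a r z)
     - cutoff L r * cutoff L z * (a r z + r * ar r z))
  - ((arz r z - crr r z) * test_r L r z + vort_th r z *
     (cutoff2 L r * cutoff L z * S r z + 2 * (cutoff1 L r * cutoff L z * (r * c r z))
      + cutoff L r * cutoff L z * (c r z + r * cr r z)))
  + ((2 * tr r z + r * trr r z) * (cutoff L r * cutoff L z * t r z)
     + r_vort_z r z * (cutoff1 L r * cutoff L z * t r z + cutoff L r * cutoff L z * tr r z)).

Definition flux_z_z L r z :=
  - ((Pz r z + (a r z * az r z + t r z * tz r z + c r z * cz r z)) * test_r L r z
  + head_pressure r z * (cutoff1 L r * cutoff1 L z * S r z - cutoff1 L r * cutoff L z * (r * a r z)
      + cutoff L r * cutoff1 L z * (r * c r z) + cutoff L r * cutoff L z * (r * cz r z)))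
  - ((azz r z - crz r z) * test_z L r z + vort_th r z *
     (cutoff L r * cutoff2 L z * S r z - 2 * (cutoff L r * cutoff1 L z * (r * a r z))
      - cutoff L r * cutoff L z * (r * az r z)))
  + r * (tzz r z * (cutoff L r * cutoff L z * t r z)
     + tz r z * (cutoff L r * cutoff1 L z * t r z + cutoff L r * cutoff L z * tz r z)).

Lemma flux_r_isdr L : L != 0 -> isdr (flux_r L) (flux_r_r L).
Proof.
move=> L0 r z.
have da := C1_r (C2_C1 Ha) r z; have dt := C1_r (C2_C1 Ht) r z.
have dc := C1_r (C2_C1 Hc) r z; have dP := C1_r HP r z.
have daz := C1_r (C2_z Ha) r z; have dcr := C1_r (C2_r Hc) r z.
have dtr := C1_r (C2_r Ht) r z; have dS := stream_isdr Hc r z.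
have dk := der_cutoff L r; have dk1 := der_cutoff1 r L0.
rewrite /flux_r /flux_r_r /head_pressure /vort_th /r_vort_z /test_r /test_z.
derive_eq ltac:(eassumption).
by rewrite /=; field.
Qed.

Lemma flux_z_isdz L : L != 0 -> isdz (flux_z L) (flux_z_z L).
Proof.
move=> L0 r z.
have da := C1_z (C2_C1 Ha) r z; have dt := C1_z (C2_C1 Ht) r z.
have dc := C1_z (C2_C1 Hc) r z; have dP := C1_z HP r z.
have daz := C1_z (C2_z Ha) r z; have dcr := C1_z (C2_r Hc) r z.
have dtz := C1_z (C2_z Ht) r z; have dS := stream_isdz Ha Hc divfree r z.
have dk := der_cutoff L z; have dk1 := der_cutoff1 z L0.
rewrite /flux_z /flux_z_z /head_pressure /vort_th /r_vort_z /test_r /test_z.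
derive_eq ltac:(eassumption).
by rewrite /=; field.
Qed.

Lemma dome_cont L : continuous (dome L).
Proof. by move=> s; exact: der_cont (der_dome L s). Qed.

Lemma flux_cont2 L : [/\ cont2 (flux_r L), cont2 (flux_r_r L) & cont2 (flux_z_z L)].
Proof.
have [[ka _ _ _ _] [kar _ _ karr karz] [kaz _ _ _ kazz]] := Ha.
have [[kt _ _ _ _] [ktr _ _ ktrr _] [ktz _ _ _ ktzz]] := Ht.
have [[kc _ _ _ _] [kcr _ _ kcrr kcrz] [kcz _ _ _ kczz]] := Hc.
have [kP _ _ kPr kPz] := HP; have kS := stream_cont2 Ha Hc divfree.
have kp := @cont2_fst R _ (@dome_cont L); have kq := @cont2_snd R _ (@dome_cont L).
split.
- change (cont2 (fun r z => flux_r L r z)).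
  rewrite /flux_r /head_pressure /vort_th /r_vort_z /test_r /test_z /cutoff1 /cutoff.
  by cont2_with ltac:(idtac; cont2_atom).
- change (cont2 (fun r z => flux_r_r L r z)).
  rewrite /flux_r_r /head_pressure /vort_th /r_vort_z /test_r /test_z /cutoff2 /cutoff1 /cutoff.
  by cont2_with ltac:(idtac; cont2_atom).
- change (cont2 (fun r z => flux_z_z L r z)).
  rewrite /flux_z_z /head_pressure /vort_th /r_vort_z /test_r /test_z /cutoff2 /cutoff1 /cutoff.
  by cont2_with ltac:(idtac; cont2_atom).
Qed.

Definition enstrophy r z := tz r z ^+ 2 + vort_th r z ^+ 2 + (r_vort_z r z / r) ^+ 2.

Lemma scaled_enstrophy_cont2 :
  cont2 (fun r z => r ^+ 2 * tz r z ^+ 2 + r ^+ 2 * vort_th r z ^+ 2 + r_vort_z r z ^+ 2).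
Proof.
have [_ [kar _ _ karr karz] [kaz _ _ _ kazz]] := Ha.
have [[kt _ _ _ _] [ktr _ _ ktrr _] [ktz _ _ _ ktzz]] := Ht.
have [_ [kcr _ _ kcrr kcrz] _] := Hc.
by rewrite /vort_th /r_vort_z; cont2_with ltac:(idtac; cont2_atom).
Qed.

Lemma cutoff_edge L s : L != 0 -> s ^+ 2 = L ^+ 2 -> cutoff L s = 0 /\ cutoff1 L s = 0.
Proof.
move=> L0 h; have b := dome_edge L0 h.
by rewrite /cutoff /cutoff1 b !expr0n /= mulr0 oppr0.
Qed.

Lemma flux_r_axis L z : flux_r L 0 z = 0.
Proof.
rewrite /flux_r /test_r /test_z /r_vort_z stream_axis t_axis /cutoff1.
by rewrite !(mul0r, mulr0, oppr0, subr0, addr0).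
Qed.

Lemma flux_r_edge L z : L != 0 -> flux_r L L z = 0.
Proof.
move=> L0; have [k k1] := cutoff_edge L0 (erefl (L ^+ 2)).
by rewrite /flux_r /test_r /test_z k k1 !(mul0r, mulr0, oppr0, subr0, addr0).
Qed.

Lemma flux_z_edge L s r : L != 0 -> s ^+ 2 = L ^+ 2 -> flux_z L r s = 0.
Proof.
move=> L0 h; have [k k1] := cutoff_edge L0 h.
by rewrite /flux_z /test_r /test_z k k1 !(mul0r, mulr0, oppr0, subr0, addr0).
Qed.

Lemma enstrophy_balance L r z : 0 < r -> 0 < L -> r <= L -> `|z| <= L ->
  forall V s w q, w = Num.sqrt (enstrophy r z) -> q = weight L r z ->
  `|a r z| <= V -> `|c r z| <= V -> `|t r z| <= V -> `|S r z| <= s ->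
  r * (q ^+ 2 * enstrophy r z) <= flux_r_r L r z + flux_z_z L r z +
  w * (6 * (r * V * (8 / L * q)) + 4 * (V * s * (8 / L * q)) + s * (96 / L ^+ 2 * q)).
Proof.
move=> r0 L0 rL zL V s w q wE qE hA hC hT hS.
have rn : r != 0 by rewrite gt_eqF.
have rL' : `|r| <= L by rewrite gtr0_norm.
have [g1 g2] := cutoff_gradient L0 rL' zL.
have g3 := cutoff_laplacian L0 r0 rL' zL.
have x2 (x : R) : 0 <= x ^+ 2 by exact: sqr_ge0.
have e0 : 0 <= enstrophy r z by rewrite /enstrophy !addr_ge0.
have w1 : `|vort_th r z| <= w.
  by rewrite wE -sqrtr_sqr ler_sqrt // /enstrophy -addrA addrCA lerDl addr_ge0.
have w2 : `|tz r z| <= w by rewrite wE -sqrtr_sqr ler_sqrt // /enstrophy -addrA lerDl addr_ge0.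
have w3 : `|r_vort_z r z / r| <= w by rewrite wE -sqrtr_sqr ler_sqrt // /enstrophy lerDr addr_ge0.
rewrite -qE in g1 g2 g3; have := error_bound (ltW r0) w1 w2 w3 hA hC hT hS g1 g2 g3.
have := energy_identity_algebra (P r z) (S r z) (cutoff L r) (cutoff1 L r) (cutoff2 L r) (cutoff L z)
   (cutoff1 L z) (cutoff2 L z)
   rn (momentum_r z r0) (momentum_theta z r0) (momentum_z z r0) (divfree r z)
   (divfree_r r z) (divfree_z r z).
rewrite /= -/(vort_th r z) -/(r_vort_z r z) -/(head_pressure r z) -/(test_r L r z) -/(test_z L r z).
rewrite -/(flux_r_r L r z) -/(flux_z_z L r z) -/(enstrophy r z) cutoff_weight -qE.
have -> : r * (r_vort_z r z / r) = r_vort_z r z by field.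
by rewrite -!mulrA => ->; rewrite lerD2l.
Qed.

(* The large context slows down the decision procedure, so only the hypotheses
   moved to the goal are kept. *)
Ltac bare_lra :=
  clear -a ar az arr arz azz t tr tz trr trz tzz c cr cz crr crz czz P Pr Pz
    Ha Ht Hc HP t_axis divfree momentum_r momentum_theta momentum_z; lra.
Local Notation E := enstrophy.

Lemma enstrophy_ge0 r z : 0 <= E r z.
Proof. by rewrite /enstrophy !addr_ge0 // sqr_ge0. Qed.

(** [error_near] on r <= M and [error_far] together with [far_field_tail] on
    r >= M. *)
Lemma enstrophy_inequality (beta C K K1 A M eta L : R) : 5 / 3 < beta -> beta < 2 ->
  0 <= C -> 0 <= K -> 0 <= K1 -> 0 <= A -> 2 <= M -> 0 < eta -> 1 <= L ->
  8 * (C * (48 * K1 + 32 * K1 * A + 96 * A)) * rho ((3 * beta - 5) / 2) M <= eta ->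
  2^-1 * M * (48 * K + 32 * K ^+ 2 * M + 96 * K * M) ^+ 2 / L <=
    eta * tail ((3 * beta - 5) / 2) M ->
  (forall r z, [/\ `|a r z| <= K, `|t r z| <= K & `|c r z| <= K]) ->
  (forall r z, 0 <= r -> `|S r z| <= K * r ^+ 2) ->
  (forall r z, 2 <= r -> [/\ `|a r z| <= K1 * (r * rho beta r),
     `|t r z| <= K1 * (r * rho beta r) & `|c r z| <= K1 * (r * rho beta r)]) ->
  (forall r z, 1 <= r -> `|S r z| <= A * (r ^+ 3 * rho beta r)) ->
  (forall r z, 1 <= r -> Num.sqrt (E r z) <= C * rho beta r) ->
  forall r z, 0 < r -> r <= L -> `|z| <= L ->
  2^-1 * r * (weight L r z ^+ 2 * E r z) <=
    flux_r_r L r z + flux_z_z L r z + eta / L * tail ((3 * beta - 5) / 2) r.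
Proof.
move=> b1 b2 C0 K0 K10 A0 M2 eta0 L1 DM NM hK hSK hfar hSA hw r z r0 rL zL.
have L0 : 0 < L by move: L1; bare_lra.
have Ln : L != 0 by rewrite gt_eqF.
have rL' : `|r| <= L by rewrite gtr0_norm.
have /andP[w0 w1] := weight_itv L0 rL' zL.
have h0 : 0 <= weight L r z ^+ 2 * E r z by rewrite mulr_ge0 ?sqr_ge0 // enstrophy_ge0.
have sE : Num.sqrt (E r z) ^+ 2 = E r z by rewrite sqr_sqrtr // enstrophy_ge0.
have [k1 k2 k3] := hK r z.
have eb := enstrophy_balance r0 L0 rL zL.
have gE x : eta / L * x = eta * x / L by field.
have [rM|Mr] := leP r M.
  have h2 := eb K `|S r z| _ _ erefl erefl k1 k3 k2 (lexx _).
  have h1 := error_near L1 r0 rM K0 (sqrtr_ge0 (E r z)) w0 (lexx K) K0 (normr_ge0 (S r z))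
    (hSK r z (ltW r0)).
  rewrite sE in h1.
  move: h1 NM; set N2 := 2^-1 * M * _ => h1 NM.
  have h3 : N2 / L ^+ 2 <= eta / L * tail ((3 * beta - 5) / 2) r.
    have h5 : eta * tail ((3 * beta - 5) / 2) M <= eta * tail ((3 * beta - 5) / 2) r.
      by rewrite ler_pM2l // tail_anti ?(ltW r0) //; move: b1; bare_lra.
    have -> : N2 / L ^+ 2 = N2 / L / L by field.
    by rewrite gE ler_pM2r ?invr_gt0 //; apply: le_trans NM h5.
  by move: h1 h2 h3; bare_lra.
have r2 : 2 <= r by exact: le_trans M2 (ltW Mr).
have r1 : 1 <= r by move: r2; bare_lra.
have [f1 f2 f3] := hfar r z r2.
have p0 : 0 < rho beta r by exact: powR_gt0.
have rn : r != 0 by rewrite gt_eqF.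
have V0 : 0 <= K1 * (r * rho beta r).
  by apply: mulr_ge0 => //; apply: mulr_ge0; exact: ltW.
have rp2 : 1 <= r ^+ 2 * rho beta r.
  have imp x : (x == 0) ==> (r != 0) by rewrite rn implybT.
  have -> : r ^+ 2 * rho beta r = r `^ (2 - beta).
    by rewrite -(powR_mulrn 2 (ltW r0)) -powRD ?imp.
  by rewrite -[X in X <= _](powRr0 r) ler_powR //; move: b2; bare_lra.
have h2 := eb _ `|S r z| _ _ erefl erefl f1 f3 f2 (lexx _).
have h1 := error_far r0 rL p0 rp2 C0 K10 A0 (sqrtr_ge0 (E r z)) (hw r z r1) w0 w1 V0
  (lexx _) (normr_ge0 (S r z)) (hSA r z r1).
have D0 : 0 <= C * (48 * K1 + 32 * K1 * A + 96 * A).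
  by apply: mulr_ge0 => //; have := mulr_ge0 K10 A0; move: K10 A0; bare_lra.
have h3 := far_field_tail b1 b2 D0 M2 (ltW Mr) DM.
have h4 : 0 <= r * (weight L r z ^+ 2 * E r z) by apply: mulr_ge0 => //; exact: ltW.
have h5 : C * (48 * K1 + 32 * K1 * A + 96 * A) * (r ^+ 4 * rho beta r ^+ 3) / L <=
    eta / L * tail ((3 * beta - 5) / 2) r by rewrite gE ler_pM2r ?invr_gt0.
by move: h1 h2 h4 h5; bare_lra.
Qed.

Lemma weight_half L r z : 0 < L -> `|r| <= L / 2 -> `|z| <= L / 2 -> 1 / 16 <= weight L r z ^+ 2.
Proof.
move=> L0; have half x : `|x| <= L / 2 -> 9 / 16 <= dome L x ^+ 2.
  move=> hx; have hx2 : x ^+ 2 <= (L / 2) ^+ 2.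
    by rewrite -(real_normK (num_real x)) lerXn2r ?nnegrE //; lra.
  have L2 : 0 < L ^+ 2 by exact: exprn_gt0.
  have h : x ^+ 2 / L ^+ 2 <= 1 / 4.
    rewrite ler_pdivrMr //; apply: le_trans hx2 _; apply: le_of_eq.
    by field.
  have : 3 / 4 <= dome L x by rewrite /dome; lra.
  by nra.
move=> /half hr /half hz.
have hwt : 1 / 4 <= weight L r z by rewrite /weight; nra.
by nra.
Qed.

Lemma enstrophy_inequality_eventually (beta C K K1 A : R) : 5 / 3 < beta -> beta < 2 ->
  0 <= C -> 0 <= K -> 0 <= K1 -> 0 <= A ->
  (forall r z, [/\ `|a r z| <= K, `|t r z| <= K & `|c r z| <= K]) ->
  (forall r z, 0 <= r -> `|S r z| <= K * r ^+ 2) ->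
  (forall r z, 2 <= r -> [/\ `|a r z| <= K1 * (r * rho beta r),
     `|t r z| <= K1 * (r * rho beta r) & `|c r z| <= K1 * (r * rho beta r)]) ->
  (forall r z, 1 <= r -> `|S r z| <= A * (r ^+ 3 * rho beta r)) ->
  (forall r z, 1 <= r -> Num.sqrt (E r z) <= C * rho beta r) ->
  exists2 p : R, 0 < p & forall eta : R, 0 < eta -> exists2 L0 : R, 1 <= L0 &
  forall L, L0 <= L -> forall r z, 0 < r -> r <= L -> `|z| <= L ->
  2^-1 * r * (weight L r z ^+ 2 * E r z) <=
    flux_r_r L r z + flux_z_z L r z + eta / L * tail p r.
Proof.
move=> b1 b2 C0 K0 K10 A0 hK hSK hfar hSA hw.
pose p := (3 * beta - 5) / 2.
have p0 : 0 < p by rewrite /p; move: b1; bare_lra.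
exists p => // eta eta0.
have D0 : 0 <= C * (48 * K1 + 32 * K1 * A + 96 * A).
  by apply: mulr_ge0 => //; have := mulr_ge0 K10 A0; move: K10 A0; bare_lra.
have [M M2 DM] := rho_small p0 D0 eta0.
have M0 : 0 <= M by apply: le_trans M2.
pose N2 := 2^-1 * M * (48 * K + 32 * K ^+ 2 * M + 96 * K * M) ^+ 2.
have N20 : 0 <= N2 by apply: mulr_ge0; [move: M0; bare_lra|exact: sqr_ge0].
have tM : 0 < eta * tail p M by rewrite mulr_gt0 // tail_gt0.
have q0 : 0 <= N2 / (eta * tail p M) by rewrite divr_ge0 // ltW.
exists (1 + N2 / (eta * tail p M)); first by rewrite lerDl.
move=> L hL.
have L1 : 1 <= L by move: q0 hL; bare_lra.
have L0 : 0 < L by move: L1; bare_lra.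
have LN : N2 / L <= eta * tail p M.
  rewrite ler_pdivrMr // [X in _ <= X]mulrC -ler_pdivrMr //.
  by move: hL; bare_lra.
exact: (enstrophy_inequality b1 b2 C0 K0 K10 A0 M2 eta0 L1 DM LN hK hSK hfar hSA hw).
Qed.

(** If the enstrophy is positive at (r0, z0), then r |w|^2 is bounded below on a
    square of half side s around that point, and the divergence inequality
    bounds the integral over this square by 2 eta / p for every eta. The scaled
    function e = r^2 |w|^2 is used because it is continuous on the whole
    plane. *)
Lemma vorticity_vanishes (p : R) : 0 < p ->
  (forall eta : R, 0 < eta -> exists2 L0 : R, 1 <= L0 &
    forall L, L0 <= L -> forall r z, 0 < r -> r <= L -> `|z| <= L ->
    2^-1 * r * (weight L r z ^+ 2 * E r z) <=
      flux_r_r L r z + flux_z_z L r z + eta / L * tail p r) ->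
  forall r z, 0 < r -> E r z = 0.
Proof.
move=> p0 ineq r0 z0 r00.
apply/eqP; rewrite eq_le enstrophy_ge0 andbT leNgt; apply/negP => Epos.
pose e r z := r ^+ 2 * tz r z ^+ 2 + r ^+ 2 * vort_th r z ^+ 2 + r_vort_z r z ^+ 2.
have eE r z : 0 < r -> e r z = r * (r * E r z).
  by move=> rp; rewrite /e /enstrophy; field; rewrite gt_eqF.
have e00 : 0 < e r0 z0 by rewrite eE // !mulr_gt0.
have [|s0 s00 hs0] := (cont2P e).1 scaled_enstrophy_cont2 r0 z0 (e r0 z0 / 2).
  by rewrite divr_gt0.
pose s := Num.min s0 r0 / 2.
have sm : 0 < Num.min s0 r0 by rewrite lt_min s00.
have sp : 0 < s by rewrite /s; lra.
have ss0 : s < s0 by have := ge_min s0 s0 r0; rewrite lexx /= /s; lra.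
have sr0 : s <= r0 by have := ge_min r0 s0 r0; rewrite lexx orbT /s; lra.
clearbody s; clear sm s00.
pose dl := 2^-1 * (1 / 16 * (e r0 z0 / (4 * r0))).
have el0 : 0 < e r0 z0 / (4 * r0) by rewrite divr_gt0 // mulr_gt0.
have dl0 : 0 < dl by rewrite /dl; move: el0; bare_lra.
pose x := s ^+ 2 * dl.
have x0 : 0 < x by rewrite mulr_gt0 // exprn_gt0.
pose eta := p * x.
have eta0 : 0 < eta by rewrite mulr_gt0.
have [L' L'1 hL'] := ineq eta eta0.
pose L := L' + 2 * (r0 + s) + 2 * (`|z0| + s).
have az0 := normr_ge0 z0.
have LL' : L' <= L by rewrite /L; move: az0 sp r00; bare_lra.
have Lr : 2 * (r0 + s) <= L by rewrite /L; move: L'1 az0 sp r00; bare_lra.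
have Lz : 2 * (`|z0| + s) <= L by rewrite /L; move: L'1 az0 sp r00; bare_lra.
have L0 : 0 < L by move: L'1 LL'; bare_lra.
have Ln : L != 0 by rewrite gt_eqF.
clearbody L.
have key := hL' L LL'.
pose G r := - (eta / L / p) * rho p (1 + r).
have dG r : 0 <= r -> is_derive r (1 : R) G (eta / L * tail p r) := tail_primitive _ p0.
have [cF1 cF1r cF2z] := flux_cont2 L.
have LL2 : (- L) ^+ 2 = L ^+ 2 by rewrite sqrrN.
have /andP[zb1 zb2] : - `|z0| <= z0 <= `|z0| by rewrite -ler_norml.
have g1 : r0 + s <= L by move: Lr r00 sp; bare_lra.
have g2 : - L <= z0 - s by move: Lz zb1 sp az0; bare_lra.
have g3 : z0 + s <= L by move: Lz zb2 sp az0; bare_lra.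
have pos r z : 0 < r < L -> - L <= z <= L ->
    0 <= flux_r_r L r z + flux_z_z L r z + eta / L * tail p r.
  move=> /andP[rp rL] zL; rewrite -ler_norml in zL.
  apply: le_trans (key r z rp (ltW rL) zL).
  apply: mulr_ge0; first by move: rp; bare_lra.
  by apply: mulr_ge0; [exact: sqr_ge0|exact: enstrophy_ge0].
have big r z : r0 - s < r < r0 + s -> z0 - s <= z <= z0 + s ->
    dl <= flux_r_r L r z + flux_z_z L r z + eta / L * tail p r.
  move=> /andP[h1 h2] /andP[h3 h4].
  have rp : 0 < r by move: h1 sr0; bare_lra.
  have rL2 : `|r| <= L / 2 by rewrite gtr0_norm //; move: h2 Lr; bare_lra.
  have zL2 : `|z| <= L / 2.
    by rewrite ler_norml; apply/andP; split; move: h3 h4 Lz zb1 zb2; bare_lra.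
  have rL : r <= L by move: h2 g1; bare_lra.
  have zL : `|z| <= L by move: zL2 L0; bare_lra.
  apply: le_trans (key r z rp rL zL).
  have he : e r0 z0 / 2 <= e r z.
    have hr : `|r - r0| < s0.
      by rewrite ltr_norml; apply/andP; split; move: h1 h2 ss0; bare_lra.
    have hz : `|z - z0| < s0.
      by rewrite ltr_norml; apply/andP; split; move: h3 h4 ss0; bare_lra.
    by have := hs0 r z hr hz; rewrite ltr_norml => /andP[+ _]; bare_lra.
  have hwt := weight_half L0 rL2 zL2.
  have rE0 : 0 <= r * E r z by apply: mulr_ge0; [exact: ltW|exact: enstrophy_ge0].
  have rE2 : e r0 z0 / (4 * r0) <= r * E r z.
    have r2 : r <= 2 * r0 by move: h2 sr0; bare_lra.
    rewrite ler_pdivrMr ?mulr_gt0 //.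
    have := ler_wpM2r rE0 r2; rewrite (eE r z rp) in he; move: he; bare_lra.
  have -> : 2^-1 * r * (weight L r z ^+ 2 * E r z) =
    2^-1 * (weight L r z ^+ 2 * (r * E r z)) by ring.
  have i0 : 0 <= 1 / 16 :> R by bare_lra.
  have := ler_pM i0 (ltW el0) hwt rE2.
  by rewrite /dl; bare_lra.
have div := divergence_inequality L0 sp (ltW dl0) sr0 g1 g2 g3 cF1 (flux_r_isdr Ln) cF1r
  (flux_z_isdz Ln) cF2z (flux_r_axis L) (fun z => flux_r_edge z Ln)
  (fun r => flux_z_edge r Ln LL2) (fun r => flux_z_edge r Ln erefl) dG pos big.
have EG : 2 * L * (G L - G 0) = 2 * x * (1 - rho p (1 + L)).
  by rewrite /G addr0 powR1 /eta; field; rewrite Ln gt_eqF.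
have xr : 0 <= x * rho p (1 + L) by apply: mulr_ge0; [exact: ltW|exact: powR_ge0].
have E4 : 4 * s ^+ 2 * dl = 4 * x by rewrite /x; ring.
by move: div xr x0; rewrite EG E4; bare_lra.
Qed.

End Energy.

(** * Vanishing of the flow *)

Section Flow.
Context {R : realType}.
Implicit Types (r z s L : R).
Local Notation rho beta r := (r `^ (- beta)).

Lemma eq0_right_closure (f : R -> R) : continuous f -> (forall s, 0 < s -> f s = 0) -> f 0 = 0.
Proof.
move=> cf f0; apply/eqP; rewrite -normr_le0; apply/ler_addgt0Pl => e e0; rewrite addr0.
have /cvgrPdist_lt/(_ e e0) := cf 0.
move=> /nbhs_ballP[d /= d0 hd].
have d2 : 0 < d / 2 by rewrite divr_gt0.
have := hd (d / 2); rewrite /ball /= sub0r normrN gtr0_norm // (f0 _ d2) subr0.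
by move=> h; apply/ltW/h; lra.
Qed.

(** The decay estimates feed [vorticity_vanishes]. Once the vorticity is zero,
    S is dominated by k r for every k > 0: the operator f_rr - f_r / r + f_zz
    maps k r to - k / r < 0, and S vanishes on the axis. *)
Lemma flow_vanishes (a ar az arr arz azz t tr tz trr trz tzz c cr cz crr crz czz
    P Pr Pz : R -> R -> R) (beta C : R) :
  C2 a ar az arr arz azz -> C2 t tr tz trr trz tzz -> C2 c cr cz crr crz czz ->
  C1 P Pr Pz ->
  (forall z, a 0 z = 0) -> (forall z, t 0 z = 0) ->
  (forall r z, a r z + r * ar r z + r * cz r z = 0) ->
  (forall r z, 0 < r ->
    a r z * ar r z + c r z * az r z - (arr r z + r^-1 * ar r z + azz r z)
    + a r z / r ^+ 2 - t r z ^+ 2 / r + Pr r z = 0) ->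
  (forall r z, 0 < r ->
    a r z * tr r z + c r z * tz r z - (trr r z + r^-1 * tr r z + tzz r z)
    + t r z / r ^+ 2 + a r z * t r z / r = 0) ->
  (forall r z, 0 < r ->
    a r z * cr r z + c r z * cz r z - (crr r z + r^-1 * cr r z + czz r z) + Pz r z = 0) ->
  decays a -> decays t -> decays c ->
  5 / 3 < beta -> beta < 2 -> 0 <= C ->
  (forall r z, 1 <= r -> Num.sqrt (enstrophy az t tr tz cr r z) <= C * rho beta r) ->
  forall r z, 0 <= r -> [/\ a r z = 0, t r z = 0 & c r z = 0].
Proof.
move=> Ha Ht Hc HP a0 t0 dv m1 m2 m3 da dt dc b1 b2 C0 hw.
have [Ka Ka0 hKa] := decays_bounded (C1_cont (C2_C1 Ha)) da.
have [Kt Kt0 hKt] := decays_bounded (C1_cont (C2_C1 Ht)) dt.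
have [Kc Kc0 hKc] := decays_bounded (C1_cont (C2_C1 Hc)) dc.
pose K := Ka + Kt + Kc.
have K0 : 0 <= K by rewrite /K; lra.
have hK r z : [/\ `|a r z| <= K, `|t r z| <= K & `|c r z| <= K].
  by have := hKa r z; have := hKt r z; have := hKc r z; rewrite /K; split; lra.
have hSK r z : 0 <= r -> `|stream c r z| <= K * r ^+ 2.
  move=> r0; have h : `|stream c r z| <= K * r ^+ 2 / 2 + 0 * r.
    apply: (stream_bound Hc r0) => s /andP[s0 _].
    have [_ _ k] := hK s z; have := ler_wpM2l s0 k; rewrite normrM ger0_norm //; lra.
  have : 0 <= K * r ^+ 2 by rewrite mulr_ge0 ?sqr_ge0.
  lra.
have x2 (x : R) : 0 <= x ^+ 2 by exact: sqr_ge0.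
have e0 r z : 0 <= enstrophy az t tr tz cr r z by exact: enstrophy_ge0.
have hwth r z : 1 <= r -> `|az r z - cr r z| <= C * rho beta r.
  move=> r1; apply: le_trans (hw r z r1).
  by rewrite -sqrtr_sqr ler_sqrt // /enstrophy -addrA addrCA lerDl addr_ge0.
have hwz r z : 1 <= r -> `|tr r z + t r z / r| <= C * rho beta r.
  move=> r1; apply: le_trans (hw r z r1).
  have -> : tr r z + t r z / r = r_vort_z t tr r z / r.
    by rewrite /r_vort_z; field; rewrite gt_eqF //; lra.
  by rewrite -sqrtr_sqr ler_sqrt // /enstrophy lerDr addr_ge0.
have [A A0 hSA] := stream_decay Ha Hc dv dc b1 b2 C0 hwth.
have hb : 0 <= beta <= 2 by apply/andP; split; lra.
have [K2 K20 hK2] := poloidal_decay Ha Hc dv hb C0 A0 hwth hSA.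
have [K3 K30 hK3] := swirl_decay b1 b2 C0 Kt0 (C1_r (C2_C1 Ht)) hKt hwz.
pose K1 := K2 + K3.
have K10 : 0 <= K1 by rewrite /K1; lra.
have hfar r z : 2 <= r -> [/\ `|a r z| <= K1 * (r * rho beta r),
     `|t r z| <= K1 * (r * rho beta r) & `|c r z| <= K1 * (r * rho beta r)].
  move=> r2; have [h1 h2] := hK2 r z r2.
  have h3 : `|t r z| <= K3 * (r * rho beta r) by apply: hK3; lra.
  have q : 0 <= r * rho beta r by rewrite mulr_ge0 ?powR_ge0 //; lra.
  have q2 := mulr_ge0 K20 q; have q3 := mulr_ge0 K30 q.
  by rewrite /K1 mulrDl; split; lra.
have [p p0 ineq] := enstrophy_inequality_eventually P Ha Hc dv m1 m2 m3 b1 b2 C0 K0 K10 A0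
  hK hSK hfar hSA hw.
have Ez := vorticity_vanishes Ha Ht Hc HP t0 dv p0 ineq.
have wz r z : 0 < r -> az r z - cr r z = 0 /\ t r z + r * tr r z = 0.
  move=> r0; have rn : r != 0 by rewrite gt_eqF.
  have /eqP := Ez r z r0; rewrite /enstrophy paddr_eq0 ?addr_ge0 // paddr_eq0 //.
  rewrite !sqrf_eq0 mulf_eq0 invr_eq0 (negbTE rn) orbF => /andP[/andP[_ /eqP h1] /eqP h2].
  by split.
have S0 r z : 0 <= r -> stream c r z = 0.
  move=> r0; apply/eqP; rewrite -normr_le0; apply/ler_addgt0Pl => e ep; rewrite addr0.
  pose k := e / (r + 1).
  have r1 : 0 < r + 1 by lra.
  have k0 : 0 < k by rewrite divr_gt0.
  have kr : k * r <= e.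
    have -> : e = k * r + k by rewrite /k; field; rewrite gt_eqF.
    lra.
  apply: le_trans kr.
  have sca := @stream_comparison_abs R (stream c) _ _ _ _ (fun r => k * r) (fun=> k) (fun=> 0)
    0 (lexx _) (stream_cont2 Ha Hc dv) (stream_isdr Hc) (stream_isdrr Hc) (stream_isdz Ha Hc dv)
    (stream_isdzz Ha).
  apply: (sca _ _ _ _ _ _ r z r0) => {sca}.
  - by move=> eps eps0; have sg := stream_growth Hc dc eps0; exact: sg.
  - move=> x x0; split; last exact: der_cst.
    by derive_eq idtac; ring.
  - move=> x x0; have : is_derive x (1 : R) (fun x => k * x) k by derive_eq idtac; ring.
    exact: der_cont.
  - by move=> x x0; rewrite mulr_ge0 // ltW.
  - by move=> y; rewrite stream_axis normr0 mulr0.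
  - move=> x y x0; rewrite stream_laplacian // (wz x y x0).1 mulr0 oppr0 normr0 addr0.
    by rewrite divr_gt0.
have pos r z : 0 < r -> [/\ a r z = 0, t r z = 0 & c r z = 0].
  move=> r0; have rn : r != 0 by rewrite gt_eqF.
  split.
  - have h := stream_isdz Ha Hc dv r z.
    have h0 : is_derive z (1 : R) (fun s => stream c r s) 0.
      rewrite (_ : (fun _ => _) = fun=> 0); first exact: der_cst.
      by apply/funext => s; apply: S0; exact: ltW.
    have /eqP := der_unique h h0.
    by rewrite oppr_eq0 mulf_eq0 (negbTE rn) => /eqP.
  - have dT x : is_derive x (1 : R) (fun x => x * t x z) (t x z + x * tr x z).
      by derive_eq ltac:(exact: (C1_r (C2_C1 Ht))); ring.
    have i1 : 0 * (r - 0) <= r * t r z - 0 * t 0 z.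
      apply: (@mean_value_ge R (fun x => x * t x z) (fun x => t x z + x * tr x z) 0 r 0
        (ltW r0) (fun x _ _ => dT x)) => x xp _.
      by rewrite (wz x z xp).2.
    have i2 : 0 * (r - 0) <= - (r * t r z) - - (0 * t 0 z).
      apply: (@mean_value_ge R (fun x => - (x * t x z)) (fun x => - (t x z + x * tr x z)) 0 r 0
        (ltW r0) (fun x _ _ => derN (dT x))) => x xp _.
      by rewrite (wz x z xp).2 oppr0.
    have /eqP : r * t r z = 0 by move: i1 i2; rewrite !mul0r; lra.
    by rewrite mulf_eq0 (negbTE rn) => /eqP.
  - have h := stream_isdr Hc r z.
    have h0 : is_derive r (1 : R) (fun s => stream c s z) 0.
      apply: der_near (der_cst (0 : R) r) _.
      by near=> x; rewrite S0 // ltW //; near: x; exact: lt_nbhsr.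
    have /eqP := der_unique h h0.
    by rewrite mulf_eq0 (negbTE rn) => /eqP.
move=> r z; rewrite le_eqVlt => /predU1P[<-|]; last exact: pos.
split=> //; apply: (eq0_right_closure (f := fun s => c s z)).
  exact: cont2_section_r (C1_cont (C2_C1 Hc)).
by move=> s s0; have [_ _] := pos s z s0.
Unshelve. all: by end_near.
Qed.

Lemma cylindrical_derivatives (f g gr gz grr grz gzz : R -> R -> R) :
  C2 g gr gz grr grz gzz -> (forall r z, 0 < r -> f r z = g r z) ->
  forall r z, 0 < r ->
  [/\ dr f r z = gr r z, dz f r z = gz r z, dr (dr f) r z = grr r z & dz (dz f) r z = gzz r z].
Proof.
move=> [h1 h2 h3] fg r z r0; have e1 := dr_eq fg (C1_r h1); have e2 := dz_eq fg (C1_z h1).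
split; [exact: e1|exact: e2|exact: dr_eq e1 (C1_r h2) _ _ r0|exact: dz_eq e2 (C1_z h3) _ _ r0].
Qed.

End Flow.

(** * From the field in space to the meridian plane *)

Section Reduction.
Context {R : realType}.
Implicit Types (r z s : R).

Definition entry (i : 'I_3) (M : 'rV[R]_3) : R := M 0 i.

Lemma entry_cont i : continuous (entry i).
Proof. exact: coord_continuous. Qed.

Lemma entry_lin i h (x y : 'rV[R]_3) : entry i (h *: (x - y)) = h * (entry i x - entry i y).
Proof. by rewrite /entry !mxE. Qed.

Lemma id_cont : continuous (fun x : R => x).
Proof. by move=> x; exact: cvg_id. Qed.

Lemma id_lin (h x y : R) : h *: (x - y) = h * (x - y).
Proof. by []. Qed.

(** At azimuth pi the frame is (- e_1, - e_2, e_3), whence the parity in r of the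
    three components. *)
Lemma axisym_entries (u : 'rV[R]_3 -> 'rV[R]_3) ur uth uz : axially_symmetric u ur uth uz ->
  forall r z, 0 < r ->
  [/\ trace (entry 0) u r z = ur r z, trace (entry 1) u r z = uth r z,
      trace (entry 2) u r z = uz r z & [/\ trace (entry 0) u (- r) z = - ur r z,
      trace (entry 1) u (- r) z = - uth r z & trace (entry 2) u (- r) z = uz r z]].
Proof.
move=> hu r z r0; have rn : r != 0 by rewrite gt_eqF.
have p1 : 0 < Defs.rad (vec3 r 0 z) by rewrite rad_vec3 gtr0_norm.
have p2 : 0 < Defs.rad (vec3 (- r) 0 z) by rewrite rad_vec3 normrN gtr0_norm.
rewrite /trace /entry (hu _ p1) (hu _ p2) !zcoord_vec3 /e_r /e_theta /e_z !rad_vec3 normrN.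
rewrite gtr0_norm // !mxE /=.
by do 2 (split; try by field).
Qed.

Lemma odd_axis (f : R -> R -> R) z : cont2 f -> (forall r, 0 < r -> f (- r) z = - f r z) -> f 0 z = 0.
Proof.
move=> cf fo.
have c1 := cont2_section_r (z := z) cf.
have h : f 0 z + f (- 0) z = 0.
  apply: (eq0_right_closure (f := fun s => f s z + f (- s) z)).
    move=> s; apply: cvgD; first exact: c1.
    apply: (@continuous_comp _ _ _ (fun s : R => - s) (fun s => f s z)); last exact: c1.
    exact: opp_continuous.
  by move=> s s0; rewrite fo // subrr.
by move: h; rewrite oppr0; lra.
Qed.

(** The stream function is built from the divergence equation on the whole
    meridian plane, negative r included; parity in r carries the equation
    across the axis. *)
Lemma divfree_extension a ar az arr arz azz c cr cz crr crz czz :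
  C2 a ar az arr arz azz -> C2 c cr cz crr crz czz ->
  (forall r z, 0 < r -> a (- r) z = - a r z) -> (forall r z, 0 < r -> c (- r) z = c r z) ->
  (forall r z, 0 < r -> a r z + r * ar r z + r * cz r z = 0) ->
  forall r z : R, a r z + r * ar r z + r * cz r z = 0.
Proof.
move=> Ha Hc ao ce dv r z; have [r0|r0|<-] := ltgtP 0 r.
- exact: dv.
- have nr : 0 < - r by lra.
  have ear : ar r z = ar (- r) z.
    have h : is_derive r (1 : R) (fun s => - a (- s) z) (ar (- r) z).
      have hn : is_derive r (1 : R) (fun s => - s) (- 1) by derive_eq idtac; ring.
      have hh := der_comp (f := fun q => a q z) hn (C1_r (C2_C1 Ha) _ _).
      by derive_eq ltac:(exact: hh); ring.
    apply: (der_unique (C1_r (C2_C1 Ha) r z)); apply: der_near h _.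
    near=> s; have s0 : 0 < - s by rewrite oppr_gt0; near: s; exact: lt_nbhsl.
    by have := ao (- s) z s0; rewrite opprK => ->.
  have ecz : cz r z = cz (- r) z.
    apply: (der_unique (C1_z (C2_C1 Hc) r z)).
    rewrite (_ : (fun s => c r s) = (fun s => c (- r) s)); first exact: (C1_z (C2_C1 Hc)).
    by apply/funext => s; have := ce (- r) s nr; rewrite opprK.
  have ea : a r z = - a (- r) z by have := ao (- r) z nr; rewrite opprK.
  have := dv (- r) z nr; rewrite ear ecz ea; lra.
- have -> : a 0 z = 0 by apply: (odd_axis (C1_cont (C2_C1 Ha))) => s; exact: ao.
  by rewrite !mul0r !addr0.
Unshelve. all: by end_near.
Qed.

Lemma enorm3_vec3 (x y w : R) : enorm3 (vec3 x y w) = Num.sqrt (x ^+ 2 + y ^+ 2 + w ^+ 2).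
Proof. by rewrite /enorm3 !big_ord_recl big_ord0 !mxE /= addr0 addrA. Qed.

Lemma trace_decays (u : 'rV[R]_3 -> 'rV[R]_3) i :
  vanishes_at_infinity u -> decays (trace (entry i) u).
Proof.
move=> hu e e0; have [M hM] := hu e e0; exists M => r z hrz.
have hx : M < enorm3 (vec3 r 0 z).
  have := enorm3_ge (vec3 r 0 z) 0; have := enorm3_ge (vec3 r 0 z) 2.
  by rewrite !mxE /= => h1 h2; case: hrz => h; [exact: lt_le_trans h h2|exact: lt_le_trans h h1].
by apply/ltW; apply: le_lt_trans (hM _ hx); exact: enorm3_ge.
Qed.

End Reduction.

Theorem theorem1p3 (R : realType)
    (u : 'rV[R]_3 -> 'rV[R]_3) (p : 'rV[R]_3 -> R)
    (ur uth uz pc : R -> R -> R)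
    (u_smooth : smooth u) (p_smooth : smooth p)
    (u_axisym : axially_symmetric u ur uth uz)
    (p_axisym : axially_symmetric_scalar p pc)
    (u_p_solution : navier_stokes_cyl ur uth uz pc)
    (u_infinity : vanishes_at_infinity u)
    (u_dirichlet : (dirichlet_integral u < +oo)%E)
    (beta : R) (beta_gt : 5 / 3 < beta) (C : R)
    (vorticity_bound : forall r z : R, 0 < r ->
       enorm3 (vec3 (vort_r uth r z) (vort_theta ur uz r z) (vort_z uth r z))
         <= C / r `^ beta) :
  forall x, u x = 0.
Proof.
have [ar [az [arr [arz [azz Ha]]]]] := trace_C2 (@entry_cont R 0) (@entry_lin R 0) (u_smooth 2).
have [tr [tz [trr [trz [tzz Ht]]]]] := trace_C2 (@entry_cont R 1) (@entry_lin R 1) (u_smooth 2).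
have [cr [cz [crr [crz [czz Hc]]]]] := trace_C2 (@entry_cont R 2) (@entry_lin R 2) (u_smooth 2).
have HP := trace_C1 (@id_cont R) (@id_lin R) (p_smooth 1).
set P := trace _ p in HP; set Pr := trace _ _ in HP; set Pz := trace _ _ in HP.
set a := trace _ u in Ha; set t := trace _ u in Ht; set c := trace _ u in Hc.
have ents := axisym_entries u_axisym.
have ea r z : 0 < r -> ur r z = a r z by move=> r0; have [<-] := ents r z r0.
have et r z : 0 < r -> uth r z = t r z by move=> r0; have [_ <-] := ents r z r0.
have ec r z : 0 < r -> uz r z = c r z by move=> r0; have [_ _ <-] := ents r z r0.
have ep r z : 0 < r -> pc r z = P r z.
  by move=> r0; rewrite /P /trace p_axisym rad_vec3 zcoord_vec3 gtr0_norm.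
have ao r z : 0 < r -> a (- r) z = - a r z.
  by move=> r0; have [_ _ _ [h _ _]] := ents r z r0; rewrite [LHS]h ea.
have to r z : 0 < r -> t (- r) z = - t r z.
  by move=> r0; have [_ _ _ [_ h _]] := ents r z r0; rewrite [LHS]h et.
have ce r z : 0 < r -> c (- r) z = c r z.
  by move=> r0; have [_ _ _ [_ _ h]] := ents r z r0; rewrite [LHS]h ec.
have a0 z : a 0 z = 0 by apply: (odd_axis (C1_cont (C2_C1 Ha))) => s; exact: ao.
have t0 z : t 0 z = 0 by apply: (odd_axis (C1_cont (C2_C1 Ht))) => s; exact: to.
have da := cylindrical_derivatives Ha ea; have dt := cylindrical_derivatives Ht et.
have dc := cylindrical_derivatives Hc ec.
have dpr := dr_eq ep (C1_r HP); have dpz := dz_eq ep (C1_z HP).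
have dv : forall r z, a r z + r * ar r z + r * cz r z = 0.
  apply: (divfree_extension Ha Hc ao ce) => r z r0.
  have [_ _ _] := u_p_solution r z r0.
  have h1 : isdr (fun s t => s * a s t) (fun s t => a s t + s * ar s t).
    by move=> s x; derive_eq ltac:(exact: (C1_r (C2_C1 Ha))); ring.
  have h2 : isdz (fun s t => s * c s t) (fun s t => s * cz s t).
    by move=> s x; derive_eq ltac:(exact: (C1_z (C2_C1 Hc))); ring.
  have e1 := dr_eq (f := fun s t => s * ur s t) _ h1 z r0.
  have e2 := dz_eq (f := fun s t => s * uz s t) _ h2 z r0.
  by rewrite e1 ?e2 // => x y x0; rewrite ?ea ?ec.
have m1 r z : 0 < r -> a r z * ar r z + c r z * az r z - (arr r z + r^-1 * ar r z + azz r z)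
    + a r z / r ^+ 2 - t r z ^+ 2 / r + Pr r z = 0.
  move=> r0; have [h _ _ _] := u_p_solution r z r0; have [e1 e2 e3 e4] := da r z r0.
  by move: h; rewrite /b_grad /Delta0 e1 e2 e3 e4 dpr // ea // et // ec.
have m2 r z : 0 < r -> a r z * tr r z + c r z * tz r z - (trr r z + r^-1 * tr r z + tzz r z)
    + t r z / r ^+ 2 + a r z * t r z / r = 0.
  move=> r0; have [_ h _ _] := u_p_solution r z r0; have [e1 e2 e3 e4] := dt r z r0.
  by move: h; rewrite /b_grad /Delta0 e1 e2 e3 e4 ea // et // ec.
have m3 r z : 0 < r -> a r z * cr r z + c r z * cz r z - (crr r z + r^-1 * cr r z + czz r z)
    + Pz r z = 0.
  move=> r0; have [_ _ h _] := u_p_solution r z r0; have [e1 e2 e3 e4] := dc r z r0.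
  by move: h; rewrite /b_grad /Delta0 e1 e2 e3 e4 dpz // ea // ec.
pose b := Num.min beta (11 / 6).
have b1 : 5 / 3 < b by rewrite lt_min beta_gt /=; lra.
have b2 : b < 2 by rewrite gt_min; apply/orP; right; lra.
have C0 : 0 <= C.
  have := vorticity_bound 1 0 ltr01; rewrite powR1 divr1; apply: le_trans; exact: sqrtr_ge0.
have hw r z : 1 <= r -> Num.sqrt (enstrophy az t tr tz cr r z) <= C * r `^ (- b).
  move=> r1; have r0 : 0 < r by lra.
  have h1 : isdr (fun s x => s * t s x) (fun s x => t s x + s * tr s x).
    by move=> s x; derive_eq ltac:(exact: (C1_r (C2_C1 Ht))); ring.
  have e1 := dr_eq (f := fun s x => s * uth s x) _ h1 z r0.
  have [_ e2 _ _] := dt r z r0; have [_ e3 _ _] := da r z r0; have [e4 _ _ _] := dc r z r0.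
  have := vorticity_bound r z r0.
  rewrite enorm3_vec3 /vort_r /vort_theta /vort_z e1; last by move=> x y x0; rewrite et.
  rewrite e2 e3 e4 sqrrN -/(vort_th az cr r z) -/(r_vort_z t tr r z) [r^-1 * _]mulrC.
  move=> h; apply: le_trans h _; rewrite -powRN; apply: ler_wpM2l => //.
  by apply: ler_powR => //; rewrite lerN2 ge_min lexx.
have fv := flow_vanishes Ha Ht Hc HP a0 t0 dv m1 m2 m3 (trace_decays 0 u_infinity)
  (trace_decays 1 u_infinity) (trace_decays 2 u_infinity) b1 b2 C0 hw.
move=> x; have [x0|x0] := ltP 0 (Defs.rad x).
  have [k1 k2 k3] := fv _ (zcoord x) (ltW x0).
  by rewrite (u_axisym x x0) ea // et // ec // k1 k2 k3 !scale0r !addr0.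
have r0 : Defs.rad x = 0 by apply/eqP; rewrite eq_le x0 sqrtr_ge0.
have : x 0 0 ^+ 2 + x 0 1 ^+ 2 == 0.
  by rewrite -[X in X == _]sqr_sqrtr ?addr_ge0 ?sqr_ge0 // -/(Defs.rad x) r0 expr0n.
rewrite paddr_eq0 ?sqr_ge0 // !sqrf_eq0 => /andP[/eqP x00 /eqP x01].
have -> : x = vec3 0 0 (x 0 2).
  by apply/rowP; apply: ord3_cases; rewrite !mxE.
have [k1 k2 k3] := fv 0 (x 0 2) (lexx 0).
by apply/rowP; apply: ord3_cases; rewrite [RHS]mxE; [exact: k1|exact: k2|exact: k3].
Qed.
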